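(* Let $E_s^{\mathrm{cl}}=(E_1^0(\cdot,s),\dots,E_r^0(\cdot,s))$ be the raw Poincaré family. After passing to $\Gamma\backslash G_\infty/\mathcal K\cong V(Y)$, this column family is precisely the constant-term-normalized family $\mathcal E_s$, i.e. $E_c^0(\cdot,s)=\mathcal E_s(e_c)$ for $1\le c\le r$, as meromorphic families. In particular, $$M(s)=\mathcal S_{\mathrm{aut}}(s)=W^{-1/2}S(q^{s-1/2})W^{1/2},$$ where $M(s)=(M_{dc}(s))_{d,c}$ is the classical constant-term matrix of the raw Poincaré family.
   Context: Arithmetic setting. Let $k$ be a global function field with constant field $\mathbb F_q$, $\infty$ a place of degree one, and identify $k_\infty$ with $K=\mathbb F_q(\!(t^{-1})\!)$; let $\mathcal O=\mathbb F_q[\![t^{-1}]\!]$, $\mathbf G=\mathrm{PGL}_2$, $G_\infty=\mathbf G(k_\infty)$, $\mathcal K=\mathrm{PGL}_2(\mathcal O)$, $G_f=\mathbf G(\mathbb A_{k,f})$ (finite adeles, away from $\infty$), $K_f<G_f$ compact open, $g_0\in G_f$ a representative of a class in $\mathbf G(k)\backslash G_f/K_f$, and $\Gamma=\mathbf G(k)\cap g_0K_fg_0^{-1}<G_\infty$. Let $\mathcal T$ be the $(q+1)$-regular Bruhat–Tits tree of $G_\infty$, $V(\mathcal T)=G_\infty/\mathcal K$, $Y=\Gamma\backslash\mathcal T$. Quotient. For a vertex $v$ of $Y$ with lift $\widetilde v$ let $\Gamma_v=\operatorname{Stab}_\Gamma(\widetilde v)$, $\lambda(v)=|\Gamma_v|^{-1}$.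 The adjacency operator is $(Af)(v)=\sum_e[\Gamma_v:\Gamma_e]f(t(e))$, the sum over representatives $e$ of $\Gamma_v$-orbits of oriented tree edges issuing from $\widetilde v$, $\Gamma_e=\operatorname{Stab}_{\Gamma_v}(e)$, $t(e)$ the terminal quotient vertex. Cusps. $Y$ has $r$ cusps. For each cusp $c$ choose its endpoint $\xi_c\in\mathbb P^1(k)$, let $P_c=\operatorname{Stab}_{\mathbf G}(\xi_c)$ with unipotent radical $N_c$, $\Gamma_c=\Gamma\cap P_c(k)$, and let $h_c$ be an integer-valued Busemann height on $V(\mathcal T)$ increasing towards $\xi_c$, satisfying $h_c(pg\mathcal K)-h_c(g\mathcal K)=-v_\infty(\alpha_c(p))$ for $p\in P_c(K)$, where $\alpha_c:P_c\to\mathbb G_m$ is the root character ($a/d$ on the class of $\left(\begin{smallmatrix}a&*\\0&d\end{smallmatrix}\right)$ after $k$-rational conjugation taking $\xi_c$ to $[1:0]$) and $v_\infty(t^{-1})=1$. The cusps are cut deep enough that the remaining vertices $(c,n)$, $n\ge1$, of the $c$-th ray have representatives $g_{c,n}\mathcal K$ with $h_c(g_{c,n}\mathcal K)=n$; the horoballs $\{h_c\ge1\}$ have disjoint distinct $\Gamma$-translates and stabilizer $\Gamma_c$; and $\Gamma_c\backslash h_c^{-1}(n)$ maps to the single vertex $(c,n)$ for every $n\ge1$. The complement of all $(c,n)$ in $V(Y)$ is a finite core of $d\ge1$ vertices; $(Af)(c,n)=qf(c,n-1)+f(c,n+1)$ for $n\ge2$, and $\lambda(c,n)=w_c(q+1)q^{-n}$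 with $w_c>0$; $W=\operatorname{diag}(w_1,\dots,w_r)$. Poincaré series. $f_{c,s}(g)=q^{sh_c(g\mathcal K)}$ is left $\Gamma_c$- and right $\mathcal K$-invariant. For $\Re s>1$, $E_c^0(g,s)=\sum_{\gamma\in\Gamma_c\backslash\Gamma}f_{c,s}(\gamma g)$, which continues meromorphically in $s$. With $E_c^0(d,n;s)=E_c^0(g_{d,n},s)$ one has $E_c^0(d,n;s)=\delta_{dc}q^{ns}+M_{dc}(s)q^{n(1-s)}$; this defines $M(s)$. Graph side. With $a=\sqrt q$ and $Uf=\lambda^{1/2}f$, $J=UAU^{-1}$ acts on $\mathbb C^d\oplus\bigoplus_{c=1}^r\ell^2(\mathbb N)$ as $J(u,g)=(H_Cu+Vg(1),h)$, $h(1)=ag(2)+V^*u$, $h(n)=a\{g(n-1)+g(n+1)\}$ ($n\ge2$); this defines the Hermitian matrix $H_C$ and $V:\mathbb C^r\to\mathbb C^d$. Put $F(\zeta)=H_C-a(\zeta+\zeta^{-1})I_d+\frac{\zeta^{-1}}aVV^*$ and $S(\zeta)=-I_r+\frac{\zeta^{-1}-\zeta}aV^*F(\zeta)^{-1}V$. For $b\in\mathbb C^r$, $\mathcal E_s(b)$ is the generalized eigenfunction of $A$ on $V(Y)$ with eigenvalue $q^s+q^{1-s}$ and cusp expansion $\mathcal E_s(b)(c,n)=q^{ns}b_c+q^{n(1-s)}(\mathcal S_{\mathrm{aut}}(s)b)_c$, unique when $F(q^{s-1/2})$ is invertible and $q^{s-1/2}\ne\pm1$ (continued meromorphically elsewhere);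 this defines $\mathcal S_{\mathrm{aut}}(s)$. $e_c$ denotes the standard vectors of $\mathbb C^r$. *)

(* Defs.v *)
From HB Require Import structures.
From mathcomp Require Import all_boot all_order all_algebra.
From mathcomp Require Import all_classical all_reals all_analysis.
From mathcomp Require Import finmap complex.
From mathcomp.analysis.showcase Require Import summability.

Set Implicit Arguments.
Unset Strict Implicit.
Unset Printing Implicit Defensive.

Import Order.TTheory GRing.Theory Num.Theory.
Import numFieldNormedType.Exports.

Local Open Scope quotient_scope.
Local Open Scope classical_set_scope.
Local Open Scope ring_scope.

(* Normalized discrete valuations; the junk value at 0 is fixed to be 0, so
   that two places are equal as soon as they agree on nonzero elements. *)
Record dval (L : fieldType) := Dval {
  dv_fun :> L -> int;
  dv0 : dv_fun 0 = 0;
  dvM : forall x y, x != 0 -> y != 0 -> dv_fun (x * y) = dv_fun x + dv_fun y;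
  dvD : forall x y, x != 0 -> y != 0 -> x + y != 0 ->
    Order.min (dv_fun x) (dv_fun y) <= dv_fun (x + y);
  dv_norm : exists2 x, x != 0 & dv_fun x = 1 }.

Definition dv_ge (L : fieldType) (v : dval L) (n : int) (x : L) : Prop :=
  x = 0 \/ n <= v x.

Section ValuationTheory.
Variables (L : fieldType) (v : dval L).

Lemma dv1 : v 1 = 0.
Proof.
have := dvM v (oner_neq0 L) (oner_neq0 L); rewrite mulr1 => /eqP.
by rewrite -subr_eq0 opprD addNKr oppr_eq0 => /eqP.
Qed.

Lemma dvN1 : v (- 1) = 0.
Proof.
have n0 : (-1 : L) != 0 by rewrite oppr_eq0 oner_neq0.
have := dvM v n0 n0; rewrite mulrNN mulr1 dv1 => /esym/eqP.
by rewrite -mulr2n mulrn_eq0 => /eqP.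
Qed.

Lemma dvV x : x != 0 -> v x^-1 = - v x.
Proof.
move=> x0; have := dvM v (invr_neq0 x0) x0; rewrite mulVf// dv1 => /esym/eqP.
by rewrite addr_eq0 => /eqP.
Qed.

Lemma dv_geD n x y : dv_ge v n x -> dv_ge v n y -> dv_ge v n (x + y).
Proof.
case=> [->|hx]; first by rewrite add0r.
case=> [->|hy]; first by rewrite addr0; right.
have [x0|x0] := eqVneq x 0.
  by rewrite x0 add0r; right.
have [y0|y0] := eqVneq y 0; first by rewrite y0 addr0; right.
have [s0|s0] := eqVneq (x + y) 0; first by left.
by right; apply: le_trans (dvD v x0 y0 s0); rewrite le_min hx.
Qed.

Lemma dv_ge0M x y : dv_ge v 0 x -> dv_ge v 0 y -> dv_ge v 0 (x * y).
Proof.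
case=> [->|hx]; first by rewrite mul0r; left.
case=> [->|hy]; first by rewrite mulr0; left.
have [->|x0] := eqVneq x 0; first by rewrite mul0r; left.
have [->|y0] := eqVneq y 0; first by rewrite mulr0; left.
by right; rewrite dvM// addr_ge0.
Qed.

Lemma dv_ge_mono m n x : m <= n -> dv_ge v n x -> dv_ge v m x.
Proof. by move=> mn [->|h]; [left|right; apply: le_trans h]. Qed.

End ValuationTheory.

Record subgroup (G : groupType) := Subgroup {
  sg_set :> set G;
  sg1 : sg_set 1%g;
  sgM : forall x y, sg_set x -> sg_set y -> sg_set (x * y)%g;
  sgV : forall x, sg_set x -> sg_set (x^-1)%g }.


Section PGL2.
Variable L : fieldType.

Definition GL2 := {A : 'M[L]_2 | A \in unitmx}.

Definition pgl_rel (A B : GL2) : bool :=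
  `[< exists2 c : L, c != 0 & val A = c *: val B >].

Lemma pgl_rel_refl : reflexive pgl_rel.
Proof. by move=> A; apply/asboolP; exists 1; rewrite ?oner_neq0// scale1r. Qed.

Lemma pgl_rel_sym : symmetric pgl_rel.
Proof.
suff H A B : pgl_rel A B -> pgl_rel B A by move=> A B; apply/idP/idP; exact: H.
move=> /asboolP[c c0 e]; apply/asboolP; exists c^-1; rewrite ?invr_neq0//.
by rewrite e scalerA mulVf// scale1r.
Qed.

Lemma pgl_rel_trans : transitive pgl_rel.
Proof.
move=> B A C /asboolP[c c0 e] /asboolP[d d0 f]; apply/asboolP.
by exists (c * d); rewrite ?mulf_neq0// e f scalerA.
Qed.

Canonical pgl_equiv := EquivRel pgl_rel pgl_rel_refl pgl_rel_sym pgl_rel_trans.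

Definition PGL2 := {eq_quot pgl_equiv}.
HB.instance Definition _ := Choice.on PGL2.
HB.instance Definition _ := EqQuotient.on PGL2.

Definition GL2_1 : GL2 := exist _ 1%:M (unitmx1 L 2).

(* the class of an invertible matrix (and of 1 for a singular one) *)
Definition pgl (A : 'M[L]_2) : PGL2 := \pi_PGL2 (insubd GL2_1 A).

(* a matrix in the class x *)
Definition mx_of (x : PGL2) : 'M[L]_2 := val (repr x).

Lemma mx_of_unit x : mx_of x \in unitmx. Proof. exact: valP. Qed.

Lemma mx_ofK x : pgl (mx_of x) = x.
Proof. by rewrite /pgl /mx_of valKd reprK. Qed.

Lemma pgl_scale c A : c != 0 -> A \in unitmx -> pgl (c *: A) = pgl A.
Proof.
move=> c0 uA; apply/eqP; rewrite /pgl eqmodE; apply/asboolP; exists c => //.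
by rewrite !insubdK// unitmxZ// unitfE.
Qed.

Lemma mx_of_pgl A : A \in unitmx ->
  exists2 c : L, c != 0 & mx_of (pgl A) = c *: A.
Proof.
move=> uA; have /eqP := mx_ofK (pgl A).
rewrite /pgl eqmodE => /asboolP[c c0].
by rewrite !insubdK ?mx_of_unit// => e; exists c.
Qed.

Definition pgl_mul (x y : PGL2) : PGL2 := pgl (mx_of x *m mx_of y).
Definition pgl_inv (x : PGL2) : PGL2 := pgl (invmx (mx_of x)).

Lemma pgl_mulE A B : A \in unitmx -> B \in unitmx ->
  pgl_mul (pgl A) (pgl B) = pgl (A *m B).
Proof.
move=> uA uB; rewrite /pgl_mul.
have [c c0 ->] := mx_of_pgl uA; have [d d0 ->] := mx_of_pgl uB.
rewrite -scalemxAl -scalemxAr scalerA pgl_scale ?mulf_neq0//.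
by rewrite unitmx_mul uA.
Qed.

Lemma pgl_invE A : A \in unitmx -> pgl_inv (pgl A) = pgl (invmx A).
Proof.
move=> uA; rewrite /pgl_inv; have [c c0 ->] := mx_of_pgl uA.
by rewrite invmxZ ?unitmxZ ?unitfE// pgl_scale ?invr_neq0// unitmx_inv.
Qed.

Lemma pgl_mulA : associative pgl_mul.
Proof.
move=> x y z; rewrite -(mx_ofK x) -(mx_ofK y) -(mx_ofK z).
by rewrite !pgl_mulE ?unitmx_mul ?mx_of_unit// mulmxA.
Qed.

Lemma pgl_mul1 : left_id (pgl 1%:M) pgl_mul.
Proof.
move=> x; rewrite -(mx_ofK x).
by rewrite pgl_mulE ?unitmx1 ?mx_of_unit// mul1mx.
Qed.

Lemma pgl_1mul : right_id (pgl 1%:M) pgl_mul.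
Proof.
move=> x; rewrite -(mx_ofK x).
by rewrite pgl_mulE ?unitmx1 ?mx_of_unit// mulmx1.
Qed.

Lemma pgl_mulV : left_inverse (pgl 1%:M) pgl_inv pgl_mul.
Proof.
move=> x; rewrite -(mx_ofK x) pgl_invE ?mx_of_unit//.
by rewrite pgl_mulE ?unitmx_inv ?mx_of_unit// mulVmx// mx_of_unit.
Qed.

Lemma pgl_Vmul : right_inverse (pgl 1%:M) pgl_inv pgl_mul.
Proof.
move=> x; rewrite -(mx_ofK x) pgl_invE ?mx_of_unit//.
by rewrite pgl_mulE ?unitmx_inv ?mx_of_unit// mulmxV// mx_of_unit.
Qed.

HB.instance Definition _ :=
  isGroup.Build PGL2 pgl_mulA pgl_mul1 pgl_1mul pgl_mulV pgl_Vmul.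

End PGL2.

Definition PGL2_map (k L : fieldType) (f : {rmorphism k -> L}) (x : PGL2 k) :
  PGL2 L := pgl (map_mx f (mx_of x)).

Section PGL2Map.
Variables (k L : fieldType) (f : {rmorphism k -> L}).

Lemma PGL2_map_pgl A : A \in unitmx -> PGL2_map f (pgl A) = pgl (map_mx f A).
Proof.
move=> uA; rewrite /PGL2_map; have [c c0 ->] := mx_of_pgl uA.
by rewrite map_mxZ pgl_scale ?fmorph_eq0// map_unitmx.
Qed.

Lemma PGL2_map1 : PGL2_map f 1%g = 1%g.
Proof.
by rewrite [X in PGL2_map f X]/(pgl 1%:M) PGL2_map_pgl ?unitmx1// map_mx1.
Qed.

Lemma PGL2_mapM x y : PGL2_map f (x * y)%g = (PGL2_map f x * PGL2_map f y)%g.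
Proof.
rewrite [(x * y)%g]/(pgl (mx_of x *m mx_of y)).
rewrite PGL2_map_pgl ?unitmx_mul ?mx_of_unit// map_mxM.
by rewrite -pgl_mulE ?map_unitmx ?mx_of_unit.
Qed.

Lemma PGL2_mapV x : PGL2_map f (x^-1)%g = (PGL2_map f x)^-1%g.
Proof.
apply: (mulgI (PGL2_map f x)).
by rewrite -PGL2_mapM !mulgV PGL2_map1.
Qed.

Lemma image_subgroup1 (H : subgroup (PGL2 k)) : (PGL2_map f @` H) 1%g.
Proof. by exists 1%g; [exact: sg1|exact: PGL2_map1]. Qed.

Lemma image_subgroupM (H : subgroup (PGL2 k)) x y :
  (PGL2_map f @` H) x -> (PGL2_map f @` H) y -> (PGL2_map f @` H) (x * y)%g.
Proof.
move=> [a Ha <-] [b Hb <-]; exists (a * b)%g; [exact: sgM|exact: PGL2_mapM].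
Qed.

Lemma image_subgroupV (H : subgroup (PGL2 k)) x :
  (PGL2_map f @` H) x -> (PGL2_map f @` H) (x^-1)%g.
Proof. by move=> [a Ha <-]; exists (a^-1)%g; [exact: sgV|exact: PGL2_mapV]. Qed.

Definition image_subgroup (H : subgroup (PGL2 k)) : subgroup (PGL2 L) :=
  Subgroup (image_subgroup1 H) (@image_subgroupM H) (@image_subgroupV H).

End PGL2Map.


Section IntegralPGL2.
Variables (L : fieldType) (v : dval L).

Definition GL2O (A : 'M[L]_2) : Prop :=
  [/\ A \in unitmx, v (\det A) = 0 & forall i j, dv_ge v 0 (A i j)].

Definition PGL2O_set : set (PGL2 L) := [set x | exists2 A, GL2O A & x = pgl A].

Lemma GL2O_1 : GL2O 1%:M.
Proof.
split; [exact: unitmx1|by rewrite det1 dv1|move=> i j; rewrite mxE].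
by case: eqP => _; [right; rewrite dv1|left].
Qed.

Lemma GL2O_M A B : GL2O A -> GL2O B -> GL2O (A *m B).
Proof.
move=> [uA dA iA] [uB dB iB]; split; first by rewrite unitmx_mul uA.
  rewrite det_mulmx dvM ?dA ?dB//; first by rewrite -unitfE -unitmxE.
  by rewrite -unitfE -unitmxE.
move=> i j; rewrite mxE; elim/big_ind: _ => [|x y|l _]; first by left.
  exact: dv_geD.
exact: dv_ge0M.
Qed.

Lemma GL2O_V A : GL2O A -> GL2O (invmx A).
Proof.
move=> [uA dA iA]; have d0 : \det A != 0 by rewrite -unitfE -unitmxE.
split; first by rewrite unitmx_inv.
  by rewrite det_inv dvV// dA oppr0.
move=> i j; rewrite /invmx uA !mxE; apply: dv_ge0M.
  by right; rewrite dvV// dA oppr0.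
rewrite /cofactor det_mx11 !mxE; apply: dv_ge0M; last exact: iA.
by right; rewrite -signr_odd; case: odd; rewrite ?expr1 ?dvN1 ?expr0 ?dv1.
Qed.

Lemma PGL2O_1 : PGL2O_set 1%g.
Proof. by exists 1%:M => //; exact: GL2O_1. Qed.

Lemma PGL2O_M x y : PGL2O_set x -> PGL2O_set y -> PGL2O_set (x * y)%g.
Proof.
move=> [A hA ->] [B hB ->]; exists (A *m B); first exact: GL2O_M.
by rewrite -pgl_mulE//; [case: hA|case: hB].
Qed.

Lemma PGL2O_V x : PGL2O_set x -> PGL2O_set (x^-1)%g.
Proof.
move=> [A hA ->]; exists (invmx A); first exact: GL2O_V.
by rewrite -pgl_invE//; case: hA.
Qed.

Definition PGL2O : subgroup (PGL2 L) := Subgroup PGL2O_1 PGL2O_M PGL2O_V.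

(* image of the matrices of GL_2(O) congruent to 1 modulo the n-th power of the
   maximal ideal; the whole of PGL_2(O) for n = 0 *)
Definition congr_PGL2O (n : nat) : set (PGL2 L) :=
  [set x | exists A, [/\ GL2O A,
      forall i j, dv_ge v n%:Z (A i j - (i == j)%:R) & x = pgl A]].

End IntegralPGL2.


Definition global_function_field (F : finFieldType) (k : fieldType)
    (cst : {rmorphism F -> k}) : Prop :=
  (exists x : k,
     ~ algebraicOver cst x /\
     exists (n : nat) (e : 'I_n -> k), forall y : k,
       exists (p : 'I_n -> {poly F}) (p0 : {poly F}), p0 != 0 /\
         y * (map_poly cst p0).[x] = \sum_i (map_poly cst (p i)).[x] * e i) /\
  (* F is the full constant field *)
  (forall y : k, algebraicOver cst y -> exists c, y = cst c).

(* F being finite, every valuation of k is trivial on it. *)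
Notation place k := (dval k).

Definition degree_one (F : finFieldType) (k : fieldType)
    (cst : {rmorphism F -> k}) (v : place k) : Prop :=
  forall x, dv_ge v 0 x -> exists c, dv_ge v 1 (x - cst c).

Record completion (k : fieldType) (v : place k) := Completion {
  cfield : fieldType;
  cemb : {rmorphism k -> cfield};
  cval : dval cfield;
  cval_ext : forall x, cval (cemb x) = v x;
  cdense : forall (y : cfield) (n : int), exists x, dv_ge cval n (y - cemb x);
  ccomplete : forall u : nat -> cfield,
    (forall n : int, exists N, forall i j, (N <= i)%N -> (N <= j)%N ->
       dv_ge cval n (u i - u j)) ->
    exists l, forall n : int, exists N, forall i, (N <= i)%N ->
      dv_ge cval n (u i - l) }.

(* (L, v) is the field of Laurent series F((t^-1)): t^-1 is a uniformizer and
   the valuation ring is F[[t^-1]], through the usual expansion. *)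
Definition laurent_coordinate (F : finFieldType) (L : fieldType)
    (cst : F -> L) (v : dval L) (t : L) : Prop :=
  let expansion x (a : nat -> F) :=
    forall N, dv_ge v N%:Z (x - \sum_(i < N) cst (a i) * t^-1 ^+ i) in
  [/\ t != 0, v t^-1 = 1,
      forall x, dv_ge v 0 x -> exists! a, expansion x a &
      forall a, exists2 x, dv_ge v 0 x & expansion x a].


Section Adeles.
Variables (k : fieldType) (inf : place k) (kv : forall v : place k, completion v).

Definition fplace := {v : place k | v <> inf}.

(* restricted product of the PGL_2(k_v) with respect to the PGL_2(O_v) *)
Record Gf := MkGf {
  Gf_at :> forall v : fplace, PGL2 (cfield (kv (sval v)));
  Gf_ae : finite_set [set v | ~ PGL2O_set (cval (kv (sval v))) (Gf_at v)] }.

HB.instance Definition _ := gen_eqMixin Gf.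
HB.instance Definition _ := gen_choiceMixin Gf.

Lemma Gf_ext (x y : Gf) : (forall v, x v = y v) -> x = y.
Proof.
case: x y => [x hx] [y hy] /= e.
have {}e : x = y by apply: functional_extensionality_dep.
by subst y; congr MkGf; exact: Prop_irrelevance.
Qed.

Lemma Gf_one_ae : finite_set
  [set v : fplace | ~ PGL2O_set (cval (kv (sval v))) 1%g].
Proof.
apply: sub_finite_set (@finite_set0 _) => v /=; apply; exact: PGL2O_1.
Qed.

Lemma Gf_mul_ae (x y : Gf) : finite_set
  [set v : fplace | ~ PGL2O_set (cval (kv (sval v))) (x v * y v)%g].
Proof.
apply: (@sub_finite_set _ _ ([set v | ~ PGL2O_set (cval (kv (sval v))) (x v)] `|`
  [set v | ~ PGL2O_set (cval (kv (sval v))) (y v)])).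
  move=> v /= h; apply/not_andP => -[hx hy]; apply: h; exact: PGL2O_M.
by rewrite finite_setU; split; exact: Gf_ae.
Qed.

Lemma Gf_inv_ae (x : Gf) : finite_set
  [set v : fplace | ~ PGL2O_set (cval (kv (sval v))) ((x v)^-1)%g].
Proof.
apply: sub_finite_set (Gf_ae x) => v /= h hx; apply: h; exact: PGL2O_V.
Qed.

Definition Gf_one := MkGf Gf_one_ae.
Definition Gf_mul x y := MkGf (Gf_mul_ae x y).
Definition Gf_inv x := MkGf (Gf_inv_ae x).

Lemma Gf_mulA : associative Gf_mul.
Proof. by move=> x y z; apply: Gf_ext => v; exact: mulgA. Qed.
Lemma Gf_mul1 : left_id Gf_one Gf_mul.
Proof. by move=> x; apply: Gf_ext => v; exact: mul1g. Qed.
Lemma Gf_1mul : right_id Gf_one Gf_mul.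
Proof. by move=> x; apply: Gf_ext => v; exact: mulg1. Qed.
Lemma Gf_mulV : left_inverse Gf_one Gf_inv Gf_mul.
Proof. by move=> x; apply: Gf_ext => v; exact: mulVg. Qed.
Lemma Gf_Vmul : right_inverse Gf_one Gf_inv Gf_mul.
Proof. by move=> x; apply: Gf_ext => v; exact: mulgV. Qed.

HB.instance Definition _ :=
  isGroup.Build Gf Gf_mulA Gf_mul1 Gf_1mul Gf_mulV Gf_Vmul.

Definition Gf_nbhs1 (n : fplace -> nat) : set Gf :=
  [set g | forall v, congr_PGL2O (cval (kv (sval v))) (n v) (g v)].

Definition Gf_open (U : set Gf) : Prop :=
  forall g, U g -> exists2 n : fplace -> nat, finite_set [set v | n v <> 0%N] &
    forall x, Gf_nbhs1 n x -> U (g * x)%g.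

Lemma Gf_openT : Gf_open setT.
Proof.
move=> g _; exists (fun=> 0%N) => //.
by apply: sub_finite_set (@finite_set0 _) => v /=.
Qed.

Lemma Gf_openI (U V : set Gf) : Gf_open U -> Gf_open V -> Gf_open (U `&` V).
Proof.
move=> oU oV g [/oU [n fn hn] /oV [m fm hm]].
exists (fun v => maxn (n v) (m v)).
  apply: (@sub_finite_set _ _ ([set v | n v <> 0%N] `|` [set v | m v <> 0%N])).
    move=> v /= h; apply/not_andP => -[nv mv]; apply: h.
    by rewrite nv mv.
  by rewrite finite_setU.
move=> x hx; split; [apply: hn|apply: hm] => v;
  have [A [oA hA e]] := hx v; exists A; split => // i j;
  by apply: dv_ge_mono (hA i j); rewrite lez_nat ?leq_maxl ?leq_maxr.
Qed.

Lemma Gf_open_bigU (I : Type) (f : I -> set Gf) :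
  (forall i, Gf_open (f i)) -> Gf_open (\bigcup_i f i).
Proof.
move=> of_ g [i _ /of_ [n fn hn]]; exists n => // x /hn h; by exists i.
Qed.

HB.instance Definition _ :=
  isOpenTopological.Build Gf Gf_openT Gf_openI Gf_open_bigU.

Variables (Kf : subgroup Gf) (g0 : Gf).

(* PGL_2(k), diagonally embedded, intersected with g0 Kf g0^-1 *)
Definition arith_set : set (PGL2 k) :=
  [set x | exists2 u : Gf, sg_set Kf u &
    forall v : fplace, PGL2_map (cemb (kv (sval v))) x = (g0 * u * g0^-1)%g v].

Lemma arith1 : arith_set 1%g.
Proof.
by exists 1%g; [exact: sg1|move=> v; rewrite mulg1 mulgV PGL2_map1].
Qed.

Lemma arithM x y : arith_set x -> arith_set y -> arith_set (x * y)%g.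
Proof.
move=> [u Ku hu] [w Kw hw]; exists (u * w)%g; first exact: sgM.
move=> v; rewrite PGL2_mapM hu hw.
rewrite -[LHS]/(((g0 * u * g0^-1) * (g0 * w * g0^-1))%g v).
by rewrite !mulgA mulgVK.
Qed.

Lemma arithV x : arith_set x -> arith_set (x^-1)%g.
Proof.
move=> [u Ku hu]; exists (u^-1)%g; first exact: sgV.
move=> v; rewrite PGL2_mapV hu.
rewrite -[LHS]/((g0 * u * g0^-1)^-1%g v).
by rewrite !invgM invgK mulgA.
Qed.

Definition arith_group : subgroup (PGL2 k) := Subgroup arith1 arithM arithV.

End Adeles.
Section CosetSpace.
Variables (G : groupType) (H : subgroup G).
Implicit Types x y z g : G.

Definition coset_rel x y : bool := `[< sg_set H (x^-1 * y)%g >].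

Lemma coset_rel_refl : reflexive coset_rel.
Proof. by move=> x; apply/asboolP; rewrite mulVg; exact: sg1. Qed.

Lemma coset_rel_sym : symmetric coset_rel.
Proof.
suff S x y : coset_rel x y -> coset_rel y x by move=> x y; apply/idP/idP; exact: S.
by move=> /asboolP /sgV; rewrite invgM invgK => h; apply/asboolP.
Qed.

Lemma coset_rel_trans : transitive coset_rel.
Proof.
move=> y x z /asboolP h /asboolP h'; apply/asboolP.
by have := sgM h h'; rewrite mulgA mulgK.
Qed.

Canonical coset_equiv :=
  EquivRel coset_rel coset_rel_refl coset_rel_sym coset_rel_trans.

(* G/H, with the left action of G *)
Definition coset_space := {eq_quot coset_equiv}.
HB.instance Definition _ := Choice.on coset_space.
HB.instance Definition _ := EqQuotient.on coset_space.

Definition cosetH g : coset_space := \pi_coset_space g.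

Definition cact g (x : coset_space) : coset_space := cosetH (g * repr x)%g.

Lemma cactE g x : cact g (cosetH x) = cosetH (g * x)%g.
Proof.
have /eqP := reprK (cosetH x); rewrite /cosetH eqmodE => /asboolP h.
apply/eqP; rewrite /cact /cosetH eqmodE; apply/asboolP.
by rewrite invgM -mulgA mulKg.
Qed.

Lemma cact1 (x : coset_space) : cact 1%g x = x.
Proof. by rewrite -[x]reprK cactE mul1g. Qed.

Lemma cactM g g' (x : coset_space) : cact (g * g')%g x = cact g (cact g' x).
Proof.
by rewrite -[x]reprK -/(cosetH (repr x)) cactE cactE cactE mulgA.
Qed.

Variable Gam : subgroup G.

Definition orbit_rel (x y : coset_space) : bool :=
  `[< exists2 g, sg_set Gam g & y = cact g x >].

Lemma orbit_rel_refl : reflexive orbit_rel.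
Proof. by move=> x; apply/asboolP; exists 1%g; [exact: sg1|rewrite cact1]. Qed.

Lemma orbit_rel_sym : symmetric orbit_rel.
Proof.
suff S (x y : coset_space) : orbit_rel x y -> orbit_rel y x by move=> x y; apply/idP/idP; exact: S.
move=> /asboolP[g hg ->]; apply/asboolP; exists (g^-1)%g; first exact: sgV.
by rewrite -cactM mulVg cact1.
Qed.

Lemma orbit_rel_trans : transitive orbit_rel.
Proof.
move=> y x z /asboolP[g hg ->] /asboolP[g' hg' ->]; apply/asboolP.
by exists (g' * g)%g; [exact: sgM|rewrite cactM].
Qed.

Canonical orbit_equiv :=
  EquivRel orbit_rel orbit_rel_refl orbit_rel_sym orbit_rel_trans.

(* Gam\G/H *)
Definition orbit_space := {eq_quot orbit_equiv}.
HB.instance Definition _ := Choice.on orbit_space.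
HB.instance Definition _ := EqQuotient.on orbit_space.

Definition orbit_of (x : coset_space) : orbit_space := \pi_orbit_space x.

End CosetSpace.

(* cardinal of a finite set; 0 for an infinite one *)
Definition ncard (T : choiceType) (A : set T) : nat := #|` fset_set A |%fset.

Definition group_index (G : groupType) (A B : set G) : nat :=
  ncard [set [set (a * b)%g | b in B] | a in A].

(* [adj] is a G-invariant adjacency relation on G/H *)
Section QuotientGraph.
Variables (G : groupType) (H Gam : subgroup G).
Variable adj : coset_space H -> coset_space H -> Prop.

Definition vstab (x : coset_space H) : set G :=
  [set g | sg_set Gam g /\ cact g x = x].

Definition eact (g : G) (e : coset_space H * coset_space H) :=
  (cact g e.1, cact g e.2).

Definition estab (x : coset_space H) (e : coset_space H * coset_space H) : set G :=
  [set g | vstab x g /\ eact g e = e].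

Definition out_edges (x : coset_space H) : set (coset_space H * coset_space H) :=
  [set e | e.1 = x /\ adj e.1 e.2].

Definition edge_orbits (x : coset_space H) :
    set (set (coset_space H * coset_space H)) :=
  [set [set eact g e | g in vstab x] | e in out_edges x].

(* the lift of a vertex v of the quotient is [repr v] and the representative of
   an edge orbit o is [xget _ o] *)
Definition adjacency (C : nzRingType) (f : orbit_space H Gam -> C)
    (v : orbit_space H Gam) : C :=
  let x := repr v in
  \sum_(o \in edge_orbits x)
    let e := xget (x, x) o in
    (group_index (vstab x) (estab x e))%:R * f (orbit_of Gam e.2).

Definition mass (R : realType) (v : orbit_space H Gam) : R :=
  (ncard (vstab (repr v)))%:R^-1.

End QuotientGraph.

Definition diag1 (L : fieldType) (a : L) : 'M[L]_2 :=
  diag_mx (\row_(j < 2) if j == 0 then a else 1).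

(* [t] is the inverse of a uniformizer *)
Section BruhatTits.
Variables (L : fieldType) (v : dval L) (t : L).

Definition tree_vertex := coset_space (PGL2O v).

(* gK and hK are adjacent iff g^-1 h lies in K diag(t^-1, 1) K *)
Definition tree_adj (x y : tree_vertex) : Prop :=
  exists a b, [/\ sg_set (PGL2O v) a, sg_set (PGL2O v) b &
    ((repr x)^-1 * repr y = a * pgl (diag1 t^-1) * b)%g].

Definition tree_walk (x y : tree_vertex) (m : nat) : Prop :=
  exists p : nat -> tree_vertex,
    [/\ p 0%N = x, p m = y & forall i, (i < m)%N -> tree_adj (p i) (p i.+1)].

Definition tree_dist (x y : tree_vertex) (m : nat) : Prop :=
  tree_walk x y m /\ forall m', tree_walk x y m' -> (m <= m')%N.

(* The rays towards the end [xi] are the n |-> B diag(t^n, 1) K with B [1:0] =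
   xi; h is the limit, up to a constant, of n - d(x, n-th vertex). *)
Definition busemann (xi : 'cV[L]_2) (h : tree_vertex -> int) : Prop :=
  forall B : 'M[L]_2, B \in unitmx ->
    (exists mu, B *m delta_mx 0 0 = mu *: xi) ->
    exists b : int, forall x, exists N : nat, forall n m : nat, (N <= n)%N ->
      tree_dist x (cosetH (PGL2O v) (pgl (B *m diag1 (t ^+ n)))) m ->
      h x = b + n%:Z - m%:Z.

End BruhatTits.

(* points of P^1 are given by homogeneous coordinates xi *)
Definition line_stab (L : fieldType) (xi : 'cV[L]_2) : set (PGL2 L) :=
  [set p | exists mu, mx_of p *m xi = mu *: xi].

(* a/d on the upper triangular class B p B^-1 *)
Definition root_char (L : fieldType) (B : 'M[L]_2) (p : PGL2 L) : L :=
  let U := B *m mx_of p *m invmx B in U 0 0 / U 1 1.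

(* R[i], as a structure from which its norm topology is inferred *)
Definition CC (R : realType) : numClosedFieldType := R[i].

Section Complex.
Variable R : realType.
Notation C := (CC R).

Definition toC (x : R) : C := (x%:C)%C.

(* x ^ s = exp (s ln x) for x > 0 *)
Definition cpow (x : R) (s : C) : C :=
  toC (expR (complex.Re s * ln x)) *
  (cos (complex.Im s * ln x) +i* sin (complex.Im s * ln x))%C.

(* meromorphic on the whole plane: a Laurent expansion with finite principal
   part in a punctured neighbourhood of every point; the values at the poles are
   irrelevant *)
Definition meromorphic (f : C -> C) : Prop :=
  forall s0 : C, exists (N : nat) (a : nat -> C), \forall s \near s0^',
    series (fun n => a n * (s - s0) ^+ n) @ \oo --> (s - s0) ^+ N * f s.

(* equality of meromorphic families: equality off a closed discrete set *)
Definition eq_mero (T : Type) (f g : C -> T) : Prop :=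
  forall s0 : C, \forall s \near s0^', f s = g s.

Definition adjmx m n (A : 'M[C]_(m, n)) : 'M[C]_(n, m) :=
  (map_mx Num.conj A)^T.

Section GraphSide.
Variables (q : R) (r d : nat) (HC : 'M[C]_d) (V : 'M[C]_(d, r)).
Let a : C := toC (Num.sqrt q).

Definition Fmx (z : C) : 'M[C]_d :=
  HC - (a * (z + z^-1))%:M + (z^-1 / a) *: (V *m adjmx V).

Definition Smx (z : C) : 'M[C]_r :=
  - 1%:M + ((z^-1 - z) / a) *: (adjmx V *m invmx (Fmx z) *m V).

Definition zeta (s : C) : C := cpow q (s - 2^-1).

End GraphSide.

End Complex.

Section Setting.
Variables (R : realType) (k : fieldType) (inf : place k).
Variable kv : forall v : place k, completion v.
Notation C := (CC R).
Notation K := (cfield (kv inf)).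
Notation iota := (cemb (kv inf)).
Notation O := (PGL2O (cval (kv inf))).
Variables (t : K) (Gk : subgroup (PGL2 k)).

Definition VT := coset_space O.
Definition Gamma : subgroup (PGL2 K) := image_subgroup iota Gk.
Definition VY := orbit_space O Gamma.

Definition vclass (g : PGL2 K) : VY := orbit_of Gamma (cosetH O g).

Definition adjY : (VY -> C) -> VY -> C :=
  adjacency (@tree_adj K (cval (kv inf)) t) (C := C).

Definition massY (v : VY) : R := mass R v.

Variables (q : R) (r d : nat).
Variables (xi : 'I_r -> 'cV[k]_2) (h : 'I_r -> VT -> int).
Variables (gr : 'I_r -> nat -> PGL2 K) (core : 'I_d -> VY) (w : 'I_r -> R).

Definition Gamma_cusp (c : 'I_r) : set (PGL2 K) :=
  PGL2_map iota @` (sg_set Gk `&` line_stab (xi c)).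

Definition horoball (c : 'I_r) : set VT := [set x | 1 <= h c x].

(* the vertex (c, n), meaningful for n >= 1 *)
Definition cuspv (c : 'I_r) (n : nat) : VY := vclass (gr c n).

Record cusp_setting : Prop := CuspSetting {
  cs_xi : forall c, xi c != 0;
  cs_busemann : forall c, busemann t (map_mx iota (xi c)) (h c);
  cs_root : forall c (B : 'M[k]_2) (p : PGL2 K) (x : VT), B \in unitmx ->
    (exists mu, B *m xi c = mu *: delta_mx 0 0) ->
    line_stab (map_mx iota (xi c)) p ->
    h c (cact p x) - h c x = - cval (kv inf) (root_char (map_mx iota B) p);
  cs_rep : forall c n, (0 < n)%N -> h c (cosetH O (gr c n)) = n%:Z;
  cs_stab : forall c g, sg_set Gamma g ->
    (cact g @` horoball c = horoball c <-> Gamma_cusp c g);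
  cs_disj : forall c c' g g', sg_set Gamma g -> sg_set Gamma g' ->
    cact g @` horoball c = cact g' @` horoball c' \/
    (cact g @` horoball c) `&` (cact g' @` horoball c') = set0;
  cs_level : forall c n x, (0 < n)%N -> h c x = n%:Z ->
    orbit_of Gamma x = cuspv c n;
  cs_cuspv_inj : forall c c' n n', (0 < n)%N -> (0 < n')%N ->
    cuspv c n = cuspv c' n' -> c = c' /\ n = n';
  cs_core_inj : injective core;
  cs_core : forall y, (exists i, y = core i) <->
    ~ (exists c n, (0 < n)%N /\ y = cuspv c n);
  cs_adj : forall (f : VY -> C) c n, (2 <= n)%N ->
    adjY f (cuspv c n) = toC q * f (cuspv c n.-1) + f (cuspv c n.+1);
  cs_w : forall c, 0 < w c;
  cs_mass : forall c n, (0 < n)%N ->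
    massY (cuspv c n) = w c * (q + 1) * q ^- n }.

(* the function f_{c,s} on PGL_2(K) *)
Definition pterm (c : 'I_r) (s : C) (g : PGL2 K) : C :=
  cpow q (s * (h c (cosetH O g))%:~R).

Definition right_cosets (c : 'I_r) : set (set (PGL2 K)) :=
  [set [set (a * g)%g | a in Gamma_cusp c] | g in Gamma].

(* E c g s stands for E_c^0(g, s); the series is summed unconditionally, on
   the chosen representative [xget _ X] of each coset X *)
Definition poincare_family (E : 'I_r -> PGL2 K -> C -> C) : Prop :=
  (forall c g s, 1 < complex.Re s ->
    partial_sum (fun X : set (PGL2 K) =>
      if X \in right_cosets c then pterm c s (xget 1%g X * g)%g else 0) @ totally
    --> E c g s) /\
  forall c g, meromorphic (E c g).

Definition constant_term (E : 'I_r -> PGL2 K -> C -> C) (M : C -> 'M[C]_r) :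
    Prop :=
  forall c' c n, (0 < n)%N ->
    eq_mero (fun s => E c (gr c' n) s)
      (fun s => (c' == c)%:R * cpow q (n%:R * s) +
                M s c' c * cpow q (n%:R * (1 - s))).

Definition toU (f : VY -> C) (v : VY) : C := toC (Num.sqrt (massY v)) * f v.
Definition ofU (f : VY -> C) (v : VY) : C := f v / toC (Num.sqrt (massY v)).

Definition Jop (f : VY -> C) : VY -> C := toU (adjY (ofU f)).

(* A function f on V(Y) is identified with (u, g), where u lists the values of f
   on the core and g(n) those at the (c, n). *)
Definition core_part (f : VY -> C) : 'cV[C]_d := \col_i f (core i).
Definition cusp_part (f : VY -> C) (n : nat) : 'cV[C]_r :=
  \col_c f (cuspv c n).

Definition graph_model (HC : 'M[C]_d) (V : 'M[C]_(d, r)) : Prop :=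
  let a : C := toC (Num.sqrt q) in
  adjmx HC = HC /\
  forall f : VY -> C,
    (forall c, cvgn (series (fun n => `|f (cuspv c n.+1)| ^+ 2))) ->
    [/\ core_part (Jop f) = HC *m core_part f + V *m cusp_part f 1,
        cusp_part (Jop f) 1 =
          a *: cusp_part f 2 + adjmx V *m core_part f &
        forall n, (2 <= n)%N ->
          cusp_part (Jop f) n = a *: (cusp_part f n.-1 + cusp_part f n.+1)].

(* cE s b stands for the generalized eigenfunction E_s(b) *)
Definition normalized_family (HC : 'M[C]_d) (V : 'M[C]_(d, r))
    (cE : C -> 'cV[C]_r -> VY -> C) (Saut : C -> 'M[C]_r) : Prop :=
  [/\ forall s b, Fmx q HC V (zeta q s) \in unitmx ->
        zeta q s != 1 -> zeta q s != -1 ->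
        (forall v, adjY (cE s b) v = (cpow q s + cpow q (1 - s)) * cE s b v) /\
        (forall c n, (0 < n)%N -> cE s b (cuspv c n) =
           cpow q (n%:R * s) * b c 0 +
           cpow q (n%:R * (1 - s)) * (Saut s *m b) c 0),
      forall b v, meromorphic (fun s => cE s b v) &
      forall c c', meromorphic (fun s => Saut s c c')].

Definition Wsqrt : 'M[C]_r := diag_mx (\row_c toC (Num.sqrt (w c))).

End Setting.

(* Main.v *)
(** For Re s > 1, f_{c,s} is an eigenfunction of the adjacency operator of the
    tree, because by the Iwasawa decomposition every vertex has one neighbour
    whose height is larger by 1 and q neighbours whose height is smaller by 1.
    Hence so is the Poincaré series, which descends to V(Y) as a function whose
    expansion along the cusps has incoming part e_c.  By orbit-stabilizer the
    indices in the adjacency operator of Y count the neighbours in the tree, so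
    that the equation A f = (q^s + q^(1-s)) f for a function with incoming part
    b and outgoing part m reads, after conjugation by the square root of the
    mass, as
      F(zeta) u = (1/zeta - zeta) V B   and   V^* u = a (B + N),
    where u is the core part, B = W^(1/2) b, N = W^(1/2) m up to a common factor.
    When F(zeta) is invertible this determines u and gives N = S(zeta) B.  The
    determinant of F(zeta) vanishes for finitely many zeta only, and each zeta
    is attained at a discrete set of s.  So the two families agree near s = 2,
    hence everywhere by the identity theorem. *)

Require Import Defs.
From mathcomp Require Import all_boot all_order all_algebra.
From mathcomp Require Import finmap complex ring lra finfield.
From mathcomp Require Import all_classical all_reals all_analysis.
From mathcomp.analysis.showcase Require Import summability.

Set Implicit Arguments.
Unset Strict Implicit.
Unset Printing Implicit Defensive.

Import Order.TTheory GRing.Theory Num.Theory.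
Import numFieldNormedType.Exports.

Local Open Scope quotient_scope.
Local Open Scope classical_set_scope.
Local Open Scope ring_scope.

(** * Identity theorem for meromorphic functions *)

Section PuncturedNeighbourhoods.
Variable C : numClosedFieldType.

Lemma near_puncturedP (s0 : C) (P : C -> Prop) :
  (\forall s \near s0^', P s) <->
  exists2 e : C, 0 < e & forall s, s != s0 -> `|s - s0| < e -> P s.
Proof.
split=> [/nbhs_ballP[e e0 h]|[e e0 h]].
  by exists e => // s ns hs; apply: h => //; rewrite /ball /= distrC.
apply/nbhs_ballP; exists e => // s; rewrite /ball /= distrC => hs ns.
exact: h.
Qed.

Lemma near_punctured_proper (s0 : C) (P : C -> Prop) :
  (\forall s \near s0^', P s) -> exists s, P s.
Proof.
move=> /near_puncturedP[e e0 h].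
have e2 : 0 < e / 2 by rewrite divr_gt0.
exists (s0 + e / 2); apply: h; last first.
  by rewrite addrAC subrr add0r gtr0_norm// ltr_pdivrMr// mulr_natr mulr2n ltrDl.
by rewrite -subr_eq0 addrAC subrr add0r gt_eqF.
Qed.

(** At a point other than [s0], a disc of radius at most the distance to [s0] avoids the puncture,
    and one of radius [e - |s1 - s0|] stays inside the large disc. This lets a property valid around
    one point spread to nearby points. *)
Lemma near_punctured_open (s0 s1 : C) (e : C) (P : C -> Prop) :
  (forall s, s != s0 -> `|s - s0| < e -> P s) -> `|s1 - s0| < e ->
  \forall s \near s1^', P s.
Proof.
move=> h s1e; have [->|ns] := eqVneq s1 s0.
  apply/near_puncturedP; exists e => //.
  by apply: le_lt_trans s1e.
have e0 : 0 < e by apply: le_lt_trans s1e.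
have d1 : 0 < e - `|s1 - s0| by rewrite subr_gt0.
have d2 : 0 < `|s1 - s0| by rewrite normr_gt0 subr_eq0.
have cmp : (e - `|s1 - s0| >=< `|s1 - s0|)%O by apply: real_comparable; rewrite gtr0_real//.
apply/near_puncturedP; exists (Num.min (e - `|s1 - s0|) `|s1 - s0|).
  by rewrite comparable_lt_min // d1.
move=> s _; rewrite comparable_lt_min // => /andP[h1 h2]; apply: h.
  by apply: contraTneq h2 => ->; rewrite distrC ltxx.
have -> : s - s0 = (s - s1) + (s1 - s0) by rewrite subrKA.
by apply: le_lt_trans (ler_normD _ _) _; rewrite -ltrBrDr.
Qed.

(** The extra term [2 * t ^+ (m + n)] bounds the remaining tail and makes the induction close: each
    step uses only [t ^+ N + 2 * t ^+ N.+1 <= 2 * t ^+ N]. *)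
Lemma geometric_tail (t : C) (m n : nat) : 0 <= t -> t <= 2^-1 ->
  (\sum_(m <= i < m + n) t ^+ i) + 2 * t ^+ (m + n) <= 2 * t ^+ m.
Proof.
move=> t0 t2; elim: n => [|n IH]; first by rewrite addn0 big_geq// add0r.
apply: le_trans IH; rewrite addnS big_nat_recr ?leq_addr//= -addrA lerD2l.
rewrite exprS -subr_ge0.
rewrite [X in 0 <= X](_ : _ = (1 - 2 * t) * t ^+ (m + n)); last by ring.
by rewrite mulr_ge0 ?exprn_ge0// subr_ge0 mulrC -ler_pdivlMr// div1r.
Qed.

(** Either all coefficients vanish, and so do all the sums, or the first nonzero coefficient governs
    the sums close to 0. Only punctured neighbourhoods occur, to match the definition of
    [meromorphic]. *)
Lemma powser_isolated_zeros (a : nat -> C) (G : C -> C) :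
  (\forall z \near (0 : C)^', series (fun n => a n * z ^+ n) @ \oo --> G z) ->
  (\forall z \near (0 : C)^', G z = 0) \/ (\forall z \near (0 : C)^', G z <> 0).
Proof.
move=> /near_puncturedP[e e0 h].
have [az|naz] := pselect (forall n, a n = 0).
  left; apply/near_puncturedP; exists e => // z z0 ze.
  have := h z z0 ze.
  have -> : series (fun n => a n * z ^+ n) = fun=> 0.
    by apply/funext => n; rewrite /series /= big1// => i _; rewrite az mul0r.
  by move=> /(cvg_unique _); apply => //; exact: cvg_cst.
right.
have exm : exists n, a n != 0.
  by apply: contrapT => /forallNP H; apply: naz => n; apply/eqP/negPn/negP/H.
pose m := ex_minn exm.
have am : a m != 0 by rewrite /m; case: ex_minnP.
have am0 n : (n < m)%N -> a n = 0.
  move=> nm; apply/eqP; apply: contraTT nm => an; rewrite -leqNgt /m.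
  by case: ex_minnP => k _; apply.
pose z1 := e / 2.
have z10 : 0 < z1 by rewrite divr_gt0.
have z1e : `|z1 - 0| < e.
  by rewrite subr0 gtr0_norm// ltr_pdivrMr// mulr_natr mulr2n ltrDl.
(* Cauchy's estimate at z1 makes the tail after a_m z^m smaller than a_m z^m. *)
have [B B0 hB] : exists2 B : C, 0 < B & forall n, `|a n * z1 ^+ n| <= B.
  have := h z1 (lt0r_neq0 z10) z1e => /cvgP /cvg_series_cvg_0.
  move=> /cvgP /cvg_seq_bounded /pinfty_ex_gt0[B B0 hB].
  by exists B => // n; exact: hB.
(* With [|z| = t * z1], the bound 1/2 serves the geometric tail, and the other bound is exactly what
   makes [2 * B * t ^+ m.+1] smaller than [|a m * z ^+ m|]. *)
pose t0 := Num.min (2^-1) (`|a m| * z1 ^+ m / (2 * B)).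
have t0r : (2^-1 >=< `|a m| * z1 ^+ m / (2 * B))%O.
  apply: real_comparable; rewrite ger0_real// ?divr_ge0 ?mulr_ge0 ?exprn_ge0//; exact: ltW.
have t00 : 0 < t0.
  by rewrite comparable_lt_min// invr_gt0 ltr0n divr_gt0 ?mulr_gt0 ?exprn_gt0 ?normr_gt0.
apply/near_puncturedP; exists (z1 * t0); first exact: mulr_gt0.
move=> z z0; rewrite subr0 => zt Gz.
pose t : C := `|z| / z1.
have tt0 : t < t0 by rewrite ltr_pdivrMr// mulrC.
have tp : 0 < t by rewrite divr_gt0// normr_gt0.
have [th ta] : t < 2^-1 /\ t < `|a m| * z1 ^+ m / (2 * B).
  by move: tt0; rewrite comparable_lt_min// => /andP.
have zE : `|z| = t * z1 by rewrite divfK// gt_eqF.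
have ze : `|z - 0| < e.
  rewrite subr0 zE; apply: le_lt_trans z1e; rewrite subr0 gtr0_norm//.
  by rewrite ler_piMl ?ltW// (lt_trans th)// invf_lt1// ltr1n.
have termB n : `|a n * z ^+ n| <= B * t ^+ n.
  rewrite normrM normrX zE exprMn mulrCA [leRHS]mulrC.
  apply: ler_wpM2l; first by rewrite exprn_ge0// ltW.
  by have := hB n; rewrite normrM normrX (gtr0_norm z10).
have gap : 0 < `|a m * z ^+ m| - 2 * B * t ^+ m.+1.
  rewrite subr_gt0 normrM normrX zE.
  have -> : 2 * B * t ^+ m.+1 = t * (2 * B) * t ^+ m by rewrite exprS; ring.
  have -> : `|a m| * (t * z1) ^+ m = `|a m| * z1 ^+ m * t ^+ m.
    by rewrite exprMn; ring.
  by rewrite ltr_pM2r ?exprn_gt0// -ltr_pdivlMr// mulr_gt0.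
(* If [G z] were 0, late partial sums would be smaller than [gap] in norm; but each is
   [a m * z ^+ m] plus a tail [T] bounded by the quantity subtracted in [gap]. *)
have := h z z0 ze; rewrite Gz => /cvgrPdist_lt /(_ _ gap) [N _ hN].
have := hN (m.+1 + N)%N; rewrite /= leq_addl => /(_ isT).
have mN : (m <= m.+1 + N)%N by rewrite addSnnS leq_addr.
rewrite sub0r normrN /series /= (big_cat_nat (leq0n m) mN)/=.
rewrite big_nat_cond big1 ?add0r; last first.
  by move=> i /andP[/andP[_ im] _]; rewrite am0// mul0r.
rewrite big_ltn ?ltn_addr//; set T := \sum_(_ <= _ < _) _ => hh.
have hT : `|T| <= 2 * B * t ^+ m.+1.
  apply: le_trans (ler_norm_sum _ _ _) _.
  apply: (@le_trans _ _ (\sum_(m.+1 <= i < m.+1 + N) B * t ^+ i)).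
    by apply: ler_sum => i _; exact: termB.
  rewrite -mulr_sumr [2 * B]mulrC -mulrA ler_pM2l//.
  have := @geometric_tail t m.+1 N (ltW tp) (ltW th); apply: le_trans.
  by rewrite lerDl mulr_ge0 ?exprn_ge0// ltW.
move: hh; rewrite ltrBrDr => /(le_lt_trans (lerD (lexx _) hT)).
have := ler_normB (a m * z ^+ m + T) T; rewrite addrK.
by move=> /le_lt_trans h' /h'; rewrite ltxx.
Qed.

(** Shifting the coefficients multiplies the sum by a power of [z]; this brings two Laurent
    expansions with different pole orders to a common denominator. *)
Lemma powser_mulXn (N : nat) (a : nat -> C) : exists a' : nat -> C,
  forall z l, series (fun n => a n * z ^+ n) @ \oo --> l ->
    series (fun n => a' n * z ^+ n) @ \oo --> z ^+ N * l.
Proof.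
elim: N => [|N [a' ha']].
  by exists a => z l; rewrite expr0 mul1r.
exists (fun n => if n is k.+1 then a' k else 0) => z l /ha' h.
rewrite -cvg_shiftS exprS -mulrA.
rewrite [X in X @ _](_ : _ = fun n => z * series (fun n => a' n * z ^+ n) n).
  by apply: cvgMr.
apply/funext => n; rewrite /series /= big_nat_recl// mul0r add0r mulr_sumr.
by apply: eq_bigr => i _; rewrite exprS mulrCA.
Qed.

(** After multiplication by the [(N1 + N2)]-th power of [s - s0], which vanishes only at [s0], the
    difference [f - g] becomes the sum of a power series, whose zeros are isolated unless it is
    identically 0. *)
Lemma laurent_eq_dichotomy (f g : C -> C) (s0 : C) (N1 N2 : nat)
    (a1 a2 : nat -> C) :
  (\forall s \near s0^',
     series (fun n => a1 n * (s - s0) ^+ n) @ \oo --> (s - s0) ^+ N1 * f s) ->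
  (\forall s \near s0^',
     series (fun n => a2 n * (s - s0) ^+ n) @ \oo --> (s - s0) ^+ N2 * g s) ->
  (\forall s \near s0^', f s = g s) \/ (\forall s \near s0^', f s <> g s).
Proof.
move=> /near_puncturedP[e1 e10 h1] /near_puncturedP[e2 e20 h2].
have [b1 hb1] := powser_mulXn N2 a1; have [b2 hb2] := powser_mulXn N1 a2.
pose G z := z ^+ (N1 + N2) * (f (s0 + z) - g (s0 + z)).
have e12 : (e1 >=< e2)%O by apply: real_comparable; rewrite gtr0_real//.
have shiftn (z : C) : z != 0 -> s0 + z != s0.
  by rewrite -[s0 + z == s0]subr_eq0 addrAC subrr add0r.
have [|/near_puncturedP[e e0 h]|/near_puncturedP[e e0 h]] :=
  @powser_isolated_zeros (fun n => b1 n - b2 n) G.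
- apply/near_puncturedP; exists (Num.min e1 e2).
    by rewrite comparable_lt_min// e10.
  move=> z z0; rewrite subr0 comparable_lt_min// => /andP[ze1 ze2].
  have zE : s0 + z - s0 = z by rewrite addrAC subrr add0r.
  have := h1 (s0 + z) (shiftn _ z0); rewrite zE => /(_ ze1)/hb1 k1.
  have := h2 (s0 + z) (shiftn _ z0); rewrite zE => /(_ ze2)/hb2 k2.
  have -> : G z = z ^+ N2 * (z ^+ N1 * f (s0 + z)) - z ^+ N1 * (z ^+ N2 * g (s0 + z)).
    by rewrite /G exprD; ring.
  have -> : series (fun n => (b1 n - b2 n) * z ^+ n) =
      (fun n => series (fun n => b1 n * z ^+ n) n - series (fun n => b2 n * z ^+ n) n).
    apply/funext => n; rewrite /series /= -sumrB.
    by apply: eq_bigr => i _; rewrite mulrBl.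
  exact: cvgB.
- left; apply/near_puncturedP; exists e => // s ss0 se.
  have := h (s - s0); rewrite subr_eq0 ss0 subr0 => /(_ isT se) /eqP.
  rewrite /G subrKC mulf_eq0 expf_eq0 subr_eq0 (negPf ss0) andbF /=.
  by rewrite subr_eq0 => /eqP.
- right; apply/near_puncturedP; exists e => // s ss0 se fg.
  apply: (h (s - s0)); rewrite ?subr_eq0 ?subr0//.
  by rewrite /G subrKC fg subrr mulr0.
Qed.

End PuncturedNeighbourhoods.

Section MeromorphicIdentity.
Variable R : realType.
Notation C := (CC R).

Lemma meromorphic_eq_dichotomy (f g : C -> C) (s0 : C) :
  meromorphic f -> meromorphic g ->
  (\forall s \near s0^', f s = g s) \/ (\forall s \near s0^', f s <> g s).
Proof.
move=> /(_ s0)[N1 [a1 h1]] /(_ s0)[N2 [a2 h2]].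
exact: (@laurent_eq_dichotomy C f g s0 N1 N2 a1 a2 h1 h2).
Qed.

(** A connectedness argument on the real line [gam] through [s0] (parameter 0) and [s1] (parameter
    1): the set [B] of parameters around which [f] and [g] agree is open, closed and nonempty. *)
Lemma meromorphic_identity (f g : C -> C) (s0 : C) :
  meromorphic f -> meromorphic g ->
  (\forall s \near s0^', f s = g s) -> eq_mero f g.
Proof.
move=> mf mg fg s1.
pose gam (x : R) : C := s0 + toC x * (s1 - s0).
pose B := [set x : R | \forall s \near (gam x)^', f s = g s].
have cst_dist x y : `|gam y - gam x| = toC `|y - x| * `|s1 - s0|.
  have -> : gam y - gam x = toC (y - x) * (s1 - s0).
    by rewrite /gam /toC rmorphB/=; ring.
  by rewrite normrM normc_def /= expr0n addr0 sqrtr_sqr.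
(* The summand 1 keeps the Lipschitz constant positive when [s1 = s0], so that it can be divided
   by. *)
pose L : R := complex.Re `|s1 - s0| + 1.
have L0 : 0 < L.
  by rewrite ltr_pwDr// normc_def /= sqrtr_ge0.
have lip x y : `|gam y - gam x| <= toC (`|y - x| * L).
  rewrite cst_dist [toC (_ * _)]rmorphM ler_wpM2l//; first by rewrite lecR.
  by rewrite normc_def /L normc_def /= lecR lerDl.
have propagate (P : C -> Prop) x : (\forall s \near (gam x)^', P s) ->
    \forall y \near x, \forall s \near (gam y)^', P s.
  move=> /near_puncturedP[e e0 h].
  have [e' ee'] : exists e', e = toC e'.
    by exists (complex.Re e); apply/esym/RRe_real/gtr0_real.
  have e'0 : 0 < e' by rewrite -ltcR -/(toC e') -ee'.
  apply/nbhs_ballP; exists (e' / L); first by rewrite /= divr_gt0.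
  move=> y; rewrite /ball /= distrC ltr_pdivlMr// => xy.
  apply: near_punctured_open h _.
  by apply: le_lt_trans (lip _ _) _; rewrite ee' ltcR.
have oB : open B.
  by rewrite openE => x Bx; apply: propagate.
(* Outside [B] the dichotomy leaves only [f <> g] around [gam x]; this too propagates to nearby
   parameters, where it excludes agreement. *)
have cB : closed B.
  rewrite -openC openE => x /= nBx.
  have [//|/propagate] := meromorphic_eq_dichotomy (gam x) mf mg.
  apply: filterS => y ny By.
  by have [s [fs nfs]] := near_punctured_proper (filterI By ny).
have /connected_intervalP/(_ B) : is_interval [set: R] by [].
move=> /(_ _ _ _)H.
have : B = setT.
  apply: H.
  - by exists 0; rewrite /B /= /gam /toC mul0r addr0.
  - by exists B; rewrite ?setTI.
  - by exists B; rewrite ?setTI.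
move=> /seteqP[_ /(_ 1 I)]; rewrite /B /= /gam.
by rewrite [toC 1]rmorph1 mul1r addrC subrK.
Qed.

End MeromorphicIdentity.
(** * Complex powers *)

Section ComplexPowers.
Variables (R : realType) (x : R).
Notation C := (CC R).
Implicit Types s : C.

Lemma cpowD s s' : cpow x (s + s') = cpow x s * cpow x s'.
Proof.
case: s s' => [a b] [a' b']; rewrite /cpow /= !mulrDl expRD cosD sinD.
apply/eqP; rewrite eq_complex /=; apply/andP; split; apply/eqP; ring.
Qed.

Lemma cpow0 : cpow x 0 = 1.
Proof.
rewrite /cpow /= !mul0r expR0 cos0 sin0.
by apply/eqP; rewrite eq_complex /=; apply/andP; split; apply/eqP; ring.
Qed.

Lemma cpow_neq0 s : cpow x s != 0.
Proof.
by apply/eqP => h; have /eqP := cpow0; rewrite -(subrr s) cpowD h mul0r eq_sym oner_eq0.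
Qed.

Lemma cpowN s : cpow x (- s) = (cpow x s)^-1.
Proof.
by apply: (mulfI (cpow_neq0 s)); rewrite -cpowD subrr cpow0 divff// cpow_neq0.
Qed.

Lemma cpowB s s' : cpow x (s - s') = cpow x s / cpow x s'.
Proof. by rewrite cpowD cpowN. Qed.

Lemma cpowMn n s : cpow x (n%:R * s) = cpow x s ^+ n.
Proof.
elim: n => [|n IH]; first by rewrite mul0r cpow0.
by rewrite -natr1 mulrDl mul1r cpowD IH exprSr.
Qed.

Lemma cpow1 : 0 < x -> cpow x 1 = toC x.
Proof.
move=> x0; rewrite /cpow /= mul1r mul0r cos0 sin0 lnK ?posrE//.
by apply/eqP; rewrite eq_complex /=; apply/andP; split; apply/eqP; ring.
Qed.

Lemma toC_sqrt : 0 < x -> toC (Num.sqrt x) = cpow x 2^-1.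
Proof.
move=> x0; have -> : (2^-1 : C) = toC 2^-1 by rewrite /toC fmorphV rmorph_nat.
rewrite /cpow /= mul0r cos0 sin0 -powR12_sqrt ?ltW// /powR gt_eqF//.
by apply/eqP; rewrite eq_complex /=; apply/andP; split; apply/eqP; ring.
Qed.

(** The bound on [s] puts [Im s * ln x] strictly between [- pi] and [pi], where the sine vanishes
    only at 0; the real exponential then forces [Re s = 0]. *)
Lemma cpow_eq1 s : 1 < x -> cpow x s = 1 ->
  `|s| < toC (pi / ln x) -> s = 0.
Proof.
case: s => a b x1; have l0 : 0 < ln x by rewrite ln_gt0.
move=> /eqP; rewrite /cpow eq_complex /= !mul0r subr0 addr0 => /andP[/eqP h1 /eqP h2].
rewrite normc_def /= ltcR => hs.
have s0 : sin (b * ln x) = 0.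
  by apply/eqP; move/eqP: h2; rewrite mulf_eq0 gt_eqF ?expR_gt0.
have blt : `|b * ln x| < pi.
  rewrite normrM (gtr0_norm l0) -ltr_pdivlMr//; apply: le_lt_trans hs.
  by rewrite -sqrtr_sqr ler_sqrt ?addr_ge0 ?sqr_ge0// lerDr sqr_ge0.
have b0 : b * ln x = 0.
  apply/eqP; apply: contraT => bn.
  have : 0 < sin `|b * ln x| by rewrite sin_gt0_pi// normr_gt0 bn.
  by case: (ger0P (b * ln x)) => _; rewrite ?sinN s0 ?oppr0 ltxx.
move: h1; rewrite b0 cos0 mulr1 => h1.
move/eqP: b0; rewrite mulf_eq0 (gt_eqF l0) orbF => /eqP ->.
have /eqP : a * ln x = 0 by apply: expR_inj; rewrite expR0.
by rewrite mulf_eq0 (gt_eqF l0) orbF => /eqP ->.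
Qed.

Lemma near_cpow_neq z (s0 : C) : 1 < x -> \forall s \near s0^', cpow x s <> z.
Proof.
move=> x1; have l0 : 0 < ln x by rewrite ln_gt0.
(* Half the radius of [cpow_eq1]: two solutions within [e] of [s0] differ by less than that radius,
   hence coincide. At most one solution other than [s0] has to be avoided. *)
pose e : C := toC (pi / ln x / 2).
have e0 : 0 < e by rewrite ltcR !divr_gt0// pi_gt0.
have [[s1 [s10 s1e s1z]]|none] := pselect (exists s1 : C,
    [/\ s1 != s0, `|s1 - s0| < e & cpow x s1 = z]); last first.
  apply/near_puncturedP; exists e => // s ss0 se sz; apply: none.
  by exists s.
apply/near_puncturedP; exists `|s1 - s0|; first by rewrite normr_gt0 subr_eq0.
move=> s ss0 sd sz; have : s - s1 = 0.
  apply: cpow_eq1 => //; first by rewrite cpowB sz s1z divff// -s1z cpow_neq0.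
  have -> : toC (pi / ln x) = e + e by rewrite -rmorphD /= -splitr.
  rewrite -(subrKA s0) (le_lt_trans (ler_normD _ _))// (distrC s0) ltrD//.
  exact: lt_trans s1e.
by move=> /subr0_eq e1; rewrite e1 ltxx in sd.
Qed.

End ComplexPowers.
(** * The tree of PGL_2 *)

Section Matrices2.
Variable L : fieldType.
Implicit Types A B : 'M[L]_2.

Lemma forall_ord2 (P : 'I_2 -> Prop) : P 0 -> P 1 -> forall i, P i.
Proof.
move=> P0 P1 [[|[|//]] lt_i2].
- by rewrite (_ : Ordinal _ = 0)//; apply: val_inj.
- by rewrite (_ : Ordinal _ = 1)//; apply: val_inj.
Qed.

Definition mx2 (a b c d : L) : 'M[L]_2 :=
  \matrix_(i, j) if i == 0 then (if j == 0 then a else b)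
                 else (if j == 0 then c else d).

Lemma matrix2P A B : A 0 0 = B 0 0 -> A 0 1 = B 0 1 -> A 1 0 = B 1 0 ->
  A 1 1 = B 1 1 -> A = B.
Proof.
by move=> *; apply/matrixP; apply: forall_ord2; apply: forall_ord2.
Qed.

Lemma mul2E m n (A : 'M[L]_(m, 2)) (B : 'M[L]_(2, n)) i j :
  (A *m B) i j = A i 0 * B 0 j + A i 1 * B 1 j.
Proof.
rewrite mxE big_ord_recl big_ord1; congr (_ * _ + A i _ * B _ _); exact: val_inj.
Qed.

Lemma det2E A : \det A = A 0 0 * A 1 1 - A 0 1 * A 1 0.
Proof.
rewrite (expand_det_row _ 0) big_ord_recl big_ord1 /cofactor !det_mx11 !mxE /=.
rewrite expr0 mul1r expr1 mulN1r mulrN.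
by congr (_ * A _ _ - A _ _ * A _ _); apply: val_inj.
Qed.

Lemma det_mx2 a b c d : \det (mx2 a b c d) = a * d - b * c.
Proof. by rewrite det2E !mxE. Qed.

Lemma unitmx2 A : (A \in unitmx) = (\det A != 0).
Proof. by rewrite unitmxE unitfE. Qed.

Lemma diag1E a : diag1 a = mx2 a 0 0 1.
Proof. by apply: matrix2P; rewrite !mxE. Qed.

Lemma col2P (x y : 'cV[L]_2) : x 0 0 = y 0 0 -> x 1 0 = y 1 0 -> x = y.
Proof.
move=> h0 h1; apply/matrixP => i j; rewrite !ord1; move: i.
exact: forall_ord2.
Qed.

Lemma pglM A B : A \in unitmx -> B \in unitmx ->
  pgl (A *m B) = (pgl A * pgl B)%g.
Proof. by move=> uA uB; rewrite -pgl_mulE. Qed.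

Lemma pgl_eqP A B : A \in unitmx -> B \in unitmx ->
  pgl A = pgl B <-> exists2 c : L, c != 0 & A = c *: B.
Proof.
move=> uA uB; split=> [e|[c c0 ->]]; last exact: pgl_scale.
have [c c0 eA] := mx_of_pgl uA; have [d d0 eB] := mx_of_pgl uB.
exists (c^-1 * d); first by rewrite mulf_neq0 ?invr_neq0.
by rewrite -scalerA -eB -e eA scalerA mulVf// scale1r.
Qed.

End Matrices2.

Section Cosets.
Variables (G : groupType) (H : subgroup G).

Lemma cosetH_eqP (x y : G) :
  cosetH H x = cosetH H y <-> sg_set H (x^-1 * y)%g.
Proof.
split=> [/eqP|h]; first by rewrite /cosetH eqmodE => /asboolP.
by apply/eqP; rewrite /cosetH eqmodE; apply/asboolP.
Qed.

Lemma cosetH_mulr (x y : G) : sg_set H y -> cosetH H (x * y)%g = cosetH H x.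
Proof.
by move=> Hy; apply/esym/cosetH_eqP; rewrite mulKg.
Qed.

Lemma cosetH_repr (x : coset_space H) : cosetH H (repr x) = x.
Proof. exact: reprK. Qed.

Lemma cactK (g : G) (x : coset_space H) : cact (g^-1)%g (cact g x) = x.
Proof. by rewrite -cactM mulVg cact1. Qed.

Lemma cactVK (g : G) (x : coset_space H) : cact g (cact (g^-1)%g x) = x.
Proof. by rewrite -cactM mulgV cact1. Qed.

Lemma cact_inj (g : G) : injective (@cact G H g).
Proof. exact: can_inj (cactK g). Qed.

End Cosets.

Section BruhatTitsTree.
Variables (L : fieldType) (v : dval L) (t : L) (F : finFieldType)
  (cst : {rmorphism F -> L}).
Hypotheses (t0 : t != 0) (vt : v t^-1 = 1).
Hypothesis residue : forall x, dv_ge v 0 x -> exists c, dv_ge v 1 (x - cst c).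
Let O := PGL2O v.
Let u := t^-1.

Let u0 : u != 0. Proof. exact: invr_neq0. Qed.

Lemma dv_geM m n x y : dv_ge v m x -> dv_ge v n y -> dv_ge v (m + n) (x * y).
Proof.
case=> [->|hx]; first by rewrite mul0r; left.
case=> [->|hy]; first by rewrite mulr0; left.
have [->|x0] := eqVneq x 0; first by rewrite mul0r; left.
have [->|y0] := eqVneq y 0; first by rewrite mulr0; left.
by right; rewrite dvM// lerD.
Qed.

Lemma dv_geN m x : dv_ge v m x -> dv_ge v m (- x).
Proof.
case=> [->|hx]; first by rewrite oppr0; left.
have [->|x0] := eqVneq x 0; first by rewrite oppr0; left.
by right; rewrite -mulN1r dvM ?oppr_eq0 ?oner_neq0// dvN1 add0r.
Qed.

Lemma dv_geB m x y : dv_ge v m x -> dv_ge v m y -> dv_ge v m (x - y).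
Proof. by move=> hx hy; apply: dv_geD => //; exact: dv_geN. Qed.

Lemma dv_ge0_1 : dv_ge v 0 1. Proof. by right; rewrite dv1. Qed.
Lemma dv_ge_0 m : dv_ge v m 0. Proof. by left. Qed.
Lemma dv_ge_u : dv_ge v 1 u. Proof. by right; rewrite /u vt. Qed.

Lemma dv_ge_uV x : dv_ge v 1 x -> dv_ge v 0 (t * x).
Proof.
have ht : dv_ge v (-1) t.
  by right; rewrite -[t]invrK dvV ?invr_neq0// vt.
by move=> /(dv_geM ht).
Qed.

(** In a finite field [c ^+ #|F| = c], so [v (cst c)] is killed by [#|F| - 1], which is nonzero. *)
Lemma dv_cst c : c != 0 -> v (cst c) = 0.
Proof.
move=> c0; have cc0 : cst c != 0 by rewrite fmorph_eq0.
have vX n : v (cst c ^+ n) = n%:Z * v (cst c).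
  elim: n => [|n IH]; first by rewrite expr0 dv1 mul0r.
  by rewrite exprS dvM ?expf_neq0// IH intS mulrDl mul1r.
have := vX #|F|; rewrite -rmorphXn/= finfield.expf_card => /eqP.
rewrite -subr_eq0 -{1}[v (cst c)]mul1r -mulrBl mulf_eq0 subr_eq0.
by case/orP => [/eqP[] F1|/eqP//]; have := finNzRing_gt1 F; rewrite -F1.
Qed.

Lemma dv_ge_cst c : dv_ge v 0 (cst c).
Proof.
by have [->|/dv_cst e] := eqVneq c 0; [left; rewrite rmorph0|right; rewrite e].
Qed.

Lemma cst_residue_inj c c' : dv_ge v 1 (cst c - cst c') -> c = c'.
Proof.
rewrite -rmorphB => -[/eqP|]; first by rewrite fmorph_eq0 subr_eq0 => /eqP.
move=> h; apply/eqP; rewrite -subr_eq0; apply: contraTT isT => n0.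
by rewrite dv_cst in h.
Qed.

Lemma GL2O_mx2 a b c d : v (a * d - b * c) = 0 -> a * d - b * c != 0 ->
  dv_ge v 0 a -> dv_ge v 0 b -> dv_ge v 0 c -> dv_ge v 0 d ->
  GL2O v (mx2 a b c d).
Proof.
move=> vd d0 ha hb hc hd; split; rewrite ?unitmx2 ?det_mx2//.
by apply: forall_ord2; apply: forall_ord2; rewrite !mxE.
Qed.

Lemma dv_unit_residue x : dv_ge v 0 x -> ~ dv_ge v 1 x -> x != 0 /\ v x = 0.
Proof.
case=> [->|hx] n1; first by case: n1; left.
have x0 : x != 0 by apply/eqP => x0; apply: n1; left.
split=> //; apply/eqP; rewrite eq_le hx andbT leNgt; apply/negP => h.
by apply: n1; right; rewrite -gtz0_ge1.
Qed.

(* The products g (nbr_mx i), i in [option F], represent the q + 1 cosets in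
   g K diag(t^-1, 1) K / K.  They are upper triangular, so that they move the
   height relative to the end fixed by g (upper triangular) g^-1 by a known
   amount; [None] is the neighbour lying on the ray towards that end. *)
Definition nbr_mx (o : option F) : 'M[L]_2 :=
  if o is Some b then mx2 u (cst b) 0 1 else mx2 1 0 0 u.

Lemma det_nbr_mx o : \det (nbr_mx o) = u.
Proof. by case: o => [b|]; rewrite det_mx2 ?mulr1 ?mulr0 ?mul1r ?subr0. Qed.

Lemma nbr_mx_unit o : nbr_mx o \in unitmx.
Proof. by rewrite unitmx2 det_nbr_mx. Qed.

Lemma diag1_unit : diag1 u \in unitmx.
Proof. by rewrite diag1E unitmx2 det_mx2 mulr1 mulr0 subr0. Qed.

(** Reduction modulo the maximal ideal: if the bottom right entry of [A] reduces to 0 the coset is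
    [None]; otherwise it is a unit, and the residue of [A 0 1 / A 1 1] names the coset [Some b]. *)
Lemma nbr_mx_cover A : GL2O v A ->
  exists o, exists2 B, GL2O v B & A *m diag1 u = nbr_mx o *m B.
Proof.
move=> [uA vA iA]; have ut x : u * (t * x) = x by rewrite mulrA mulVf ?mul1r.
have dA : \det A != 0 by rewrite -unitmx2.
have [h|h] := pselect (dv_ge v 1 (A 1 1)).
  exists None, (mx2 (u * A 0 0) (A 0 1) (A 1 0) (t * A 1 1)).
    have e : u * A 0 0 * (t * A 1 1) - A 0 1 * A 1 0 = \det A.
      by rewrite det2E mulrACA mulVf// mul1r.
    apply: GL2O_mx2; rewrite ?e//; last exact: dv_ge_uV.
    by apply: dv_ge0M => //; apply: dv_ge_mono dv_ge_u.
  rewrite diag1E; apply: matrix2P; rewrite !mul2E !mxE /=; rewrite ?ut; ring.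
have [d0 vd] := dv_unit_residue (iA 1 1) h.
have [b hb] : exists b, dv_ge v 1 (A 0 1 / A 1 1 - cst b).
  by apply: residue; apply: dv_ge0M => //; right; rewrite dvV// vd.
have hb' : dv_ge v 1 (A 0 1 - cst b * A 1 1).
  rewrite (_ : _ - _ = (A 0 1 / A 1 1 - cst b) * A 1 1); last by rewrite mulrBl divfK.
  by rewrite -[1]addr0; apply: dv_geM.
exists (Some b), (mx2 (A 0 0 - cst b * A 1 0) (t * (A 0 1 - cst b * A 1 1))
   (u * A 1 0) (A 1 1)).
  have e : (A 0 0 - cst b * A 1 0) * A 1 1 -
      t * (A 0 1 - cst b * A 1 1) * (u * A 1 0) = \det A.
    by rewrite det2E [t * _ * _]mulrACA mulfV// mul1r; ring.
  apply: GL2O_mx2; rewrite ?e//.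
  - by apply: dv_geB => //; apply: dv_ge0M => //; apply: dv_ge_cst.
  - exact: dv_ge_uV.
  - by apply: dv_ge0M => //; apply: dv_ge_mono dv_ge_u.
rewrite diag1E; apply: matrix2P; rewrite !mul2E !mxE /= ?mulrA ?[u * t]mulVf//; ring.
Qed.

(** An upper unipotent matrix on the left gives [Some b]; the Weyl element on both sides swaps the
    diagonal entries and gives [None]. *)
Lemma nbr_mx_double_coset o : exists A B, [/\ GL2O v A, GL2O v B &
  nbr_mx o = A *m diag1 u *m B].
Proof.
case: o => [b|].
  exists (mx2 1 (cst b) 0 1), 1%:M; split; last 1 first.
  - by rewrite mulmx1 diag1E; apply: matrix2P; rewrite !mul2E !mxE /=; ring.
  - apply: GL2O_mx2; rewrite ?mulr1 ?mulr0 ?subr0 ?dv1 ?oner_neq0//;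
      by [exact: dv_ge0_1|exact: dv_ge_cst|exact: dv_ge_0].
  - exact: GL2O_1.
have hsw : GL2O v (mx2 0 1 1 0).
  apply: GL2O_mx2; rewrite ?mulr1 ?mulr0 ?sub0r ?dvN1 ?oppr_eq0 ?oner_neq0//;
    by [exact: dv_ge0_1|exact: dv_ge_0].
exists (mx2 0 1 1 0), (mx2 0 1 1 0); split => //.
by rewrite diag1E; apply: matrix2P; rewrite !mul2E !mxE /=; ring.
Qed.

Lemma nbr_mx_inj o o' : sg_set O ((pgl (nbr_mx o))^-1 * pgl (nbr_mx o'))%g ->
  o = o'.
Proof.
move=> [B hB].
have [uB vB iB] := hB.
move=> /(congr1 (fun z => pgl (nbr_mx o) * z)%g); rewrite mulVKg.
rewrite -pglM ?nbr_mx_unit// => /pgl_eqP[]; rewrite ?unitmx_mul ?nbr_mx_unit//.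
move=> c c0; rewrite scalemxAr.
have dB : \det B != 0 by rewrite -unitmx2.
(* Both neighbour matrices have determinant [u], so the scalar [c] has valuation 0 and [c *: B] is
   still integral. Its entries can then be compared modulo the maximal ideal. *)
move=> e; have /(congr1 v) : u = u * (c ^+ 2 * \det B).
  by rewrite -{1}(det_nbr_mx o') e det_mulmx det_nbr_mx detZ.
rewrite !dvM ?mulf_neq0 ?expf_neq0// vB addr0 => /eqP.
rewrite -subr_eq0 opprD addNKr oppr_eq0 -mulr2n mulrn_eq0 /= => /eqP vc.
have iC i j : dv_ge v 0 ((c *: B) i j).
  by rewrite mxE; apply: dv_ge0M => //; right; rewrite vc.
move: (c *: B) iC e => C iC e {dB hB uB vB iB}.
have not1 : ~ dv_ge v 1 1.
  by case=> [/eqP|]; rewrite ?oner_eq0// dv1.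
have ge1u x : dv_ge v 0 x -> dv_ge v 1 (u * x).
  by move=> h; rewrite -[1]addr0; apply: dv_geM => //; exact: dv_ge_u.
have E i j := congr1 (fun M : 'M[L]_2 => M i j) e.
case: o o' E {e} => [b|] [b'|] E //.
- have := E 1 1; rewrite mul2E !mxE /= mul0r add0r mul1r => C11.
  have := E 0 1; rewrite mul2E !mxE /= -C11 mulr1 => e01.
  congr Some; apply/esym/cst_residue_inj; rewrite e01 addrK; exact: ge1u.
- have := E 1 0; rewrite mul2E !mxE /= mul0r add0r mul1r => C10.
  have := E 0 0; rewrite mul2E !mxE /= -C10 mulr0 addr0 => e00.
  by case: not1; rewrite e00; exact: ge1u.
- have := E 1 1; rewrite mul2E !mxE /= mul0r add0r => e11.
  by case: not1; rewrite e11; exact: ge1u.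
Qed.

Definition nbr (G : PGL2 L) (o : option F) : tree_vertex v :=
  cosetH O (G * pgl (nbr_mx o))%g.

Lemma nbr_injective G : injective (nbr G).
Proof.
move=> o o' /cosetH_eqP; rewrite invgM -mulgA mulKg; exact: nbr_mx_inj.
Qed.

(** [tree_adj] speaks of chosen representatives; replacing them by others changes them by elements
    of [O], which the double coset absorbs. As [G] is arbitrary, invariance under the group
    follows. *)
Lemma tree_adjP G y : tree_adj t (cosetH O G) y <-> exists o, y = nbr G o.
Proof.
rewrite /tree_adj.
have [k Ok ->] : exists2 k, sg_set O k & repr (cosetH O G) = (G * k)%g.
  exists (G^-1 * repr (cosetH O G))%g; last by rewrite mulVKg.
  by apply/cosetH_eqP; rewrite cosetH_repr.
split.
- move=> [a [b [Oa Ob e]]].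
  have [A hA kaA] : sg_set O (k * a)%g by exact: sgM.
  have [i [B hB eB]] := nbr_mx_cover hA.
  exists i; rewrite -[y]cosetH_repr /nbr.
  have -> : repr y = (G * pgl (nbr_mx i) * (pgl B * b))%g.
    rewrite -(mulVKg (G * k)%g (repr y)) e !mulgA -[(G * k * a)%g]mulgA kaA.
    rewrite -(mulgA G (pgl A)) -pglM ?diag1_unit ?eB ?pglM ?nbr_mx_unit ?mulgA//.
      by case: hB.
    by case: hA.
  by rewrite cosetH_mulr//; apply: sgM => //; exists B.
- move=> [i ->]; have [A [B [hA hB e]]] := nbr_mx_double_coset i.
  have [k' Ok' ->] : exists2 k', sg_set O k' & repr (nbr G i) = (G * pgl (nbr_mx i) * k')%g.
    exists ((G * pgl (nbr_mx i))^-1 * repr (nbr G i))%g; last by rewrite mulVKg.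
    by apply/cosetH_eqP; rewrite cosetH_repr.
  exists (k^-1 * pgl A)%g, (pgl B * k')%g; split.
  + by apply: sgM; [exact: sgV|exists A].
  + by apply: sgM => //; exists B.
  + have [uA _ _] := hA; have [uB _ _] := hB.
    rewrite e !pglM ?unitmx_mul ?uA ?diag1_unit// invgM -!mulgA; congr (_ * _)%g.
    by rewrite mulKg.
Qed.

Lemma tree_adj_cact g (x y : tree_vertex v) :
  tree_adj t x y -> tree_adj t (cact g x) (cact g y).
Proof.
rewrite -(cosetH_repr x) cactE => /tree_adjP[i ->]; apply/tree_adjP.
by exists i; rewrite /nbr cactE mulgA.
Qed.

(** The integral group is transitive on the projective line: with [xi] equal to [G] applied to
    [eta], one of the two ratios of the coordinates of [eta] is integral, and an integral matrix
    with first column proportional to [eta] can be written down. *)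
Lemma iwasawa (G : PGL2 L) (xi : 'cV[L]_2) : xi != 0 ->
  exists A : 'M[L]_2, exists2 mu, A \in unitmx /\ A *m delta_mx 0 0 = mu *: xi &
    cosetH O (pgl A) = cosetH O G.
Proof.
move=> xi0; have uG := mx_of_unit G.
have [eta xiE] : exists eta, xi = mx_of G *m eta.
  by exists (invmx (mx_of G) *m xi); rewrite mulmxA mulmxV// mul1mx.
have eta0 : eta != 0.
  by apply: contraNneq xi0 => e0; rewrite xiE e0 mulmx0.
have [k Ok [mu ek]] : exists2 k, GL2O v k & exists mu, k *m delta_mx 0 0 = mu *: eta.
  have v1 : v 1 = 0 by exact: dv1.
  have [e0|e0] := eqVneq (eta 1 0) 0.
    exists 1%:M; first exact: GL2O_1.
    have e00 : eta 0 0 != 0.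
      apply: contraNneq eta0 => e00; by apply/eqP/col2P; rewrite [RHS]mxE.
    exists (eta 0 0)^-1; rewrite mul1mx; apply: col2P; rewrite !mxE /=.
      by rewrite mulVf.
    by rewrite e0 mulr0.
  have [h|h] := pselect (dv_ge v 0 (eta 0 0 / eta 1 0)).
    exists (mx2 (eta 0 0 / eta 1 0) 1 1 0).
      apply: GL2O_mx2; rewrite ?mulr1 ?mulr0 ?sub0r ?dvN1 ?oppr_eq0 ?oner_neq0//;
        by [exact: dv_ge0_1|exact: dv_ge_0].
    exists (eta 1 0)^-1; apply: col2P; rewrite mul2E !mxE /= ?mulr1 ?mulr0 ?addr0.
      by rewrite mulrC.
    by rewrite mulVf.
  have e00 : eta 0 0 != 0.
    by apply/eqP => e00; apply: h; left; rewrite e00 mul0r.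
  exists (mx2 1 0 (eta 1 0 / eta 0 0) 1).
    apply: GL2O_mx2; rewrite ?mulr1 ?mul0r ?subr0 ?oner_neq0//;
      try by [exact: dv_ge0_1|exact: dv_ge_0].
    right; rewrite -invf_div dvV ?mulf_neq0 ?invr_neq0// oppr_ge0 leNgt.
    by apply/negP => h'; apply: h; right; exact: ltW.
  exists (eta 0 0)^-1; apply: col2P; rewrite mul2E !mxE /= ?mulr1 ?mulr0 ?addr0.
    by rewrite mulVf.
  by rewrite mulrC.
have [uk _ _] := Ok.
exists (mx_of G *m k), mu.
  split; first by rewrite unitmx_mul uG.
  by rewrite -mulmxA ek -scalemxAr -xiE.
rewrite pglM// mx_ofK; apply: cosetH_mulr; by exists k.
Qed.

Lemma mulmx_e0 (A : 'M[L]_2) i : (A *m delta_mx 0 0) i (0 : 'I_1) = A i 0.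
Proof. by rewrite mul2E !mxE /= mulr1 mulr0 addr0. Qed.

Section Heights.
Variables (xi : 'cV[L]_2) (B : 'M[L]_2) (nu : L) (h : tree_vertex v -> int).
Hypotheses (xi0 : xi != 0) (uB : B \in unitmx) (hB : B *m xi = nu *: delta_mx 0 0).
Hypothesis hroot : forall p x, line_stab xi p ->
  h (cact p x) - h x = - v (root_char B p).

(** The product [T = B *m A] fixes the line of the first basis vector, so it is upper triangular,
    and conjugating [U] by it keeps the diagonal entries. The scalar ambiguity of [mx_of] cancels in
    the quotient. *)
Lemma root_char_upper (A U : 'M[L]_2) (mu : L) : A \in unitmx ->
  A *m delta_mx 0 0 = mu *: xi -> U \in unitmx -> U 1 0 = 0 ->
  line_stab xi (pgl (A *m U *m invmx A)) /\
  root_char B (pgl (A *m U *m invmx A)) = U 0 0 / U 1 1.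
Proof.
move=> uA hA uU U10.
have mu0 : mu != 0.
  apply/eqP => mu0; move: hA; rewrite mu0 scale0r => /(congr1 (mulmx (invmx A))).
  rewrite mulmxA mulVmx// mul1mx mulmx0 => /matrixP/(_ 0 0); rewrite !mxE /= => /eqP.
  by rewrite oner_eq0.
have xiE : xi = mu^-1 *: (A *m delta_mx 0 0) by rewrite hA scalerA mulVf// scale1r.
have uX : A *m U *m invmx A \in unitmx by rewrite !unitmx_mul unitmx_inv uA uU.
have [c c0 ec] := mx_of_pgl uX.
have Ue0 : U *m delta_mx 0 0 = U 0 0 *: (delta_mx 0 0 : 'cV_2).
  by apply: col2P; rewrite mulmx_e0 !mxE /= ?mulr1// U10 mulr0.
have dU : U 0 0 * U 1 1 != 0.
  by move: uU; rewrite unitmx2 det2E U10 mulr0 subr0.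
split.
  exists (c * U 0 0); rewrite ec -scalemxAl [in LHS]xiE -scalemxAr -!mulmxA.
  rewrite (mulmxA (invmx A)) mulVmx// mul1mx Ue0 -scalemxAr hA !scalerA.
  by congr (_ *: _); field.
rewrite /root_char ec -!scalemxAr -!scalemxAl.
set X := B *m _ *m _; rewrite 2![(c *: X) _ _]mxE.
rewrite -mulf_div divff// mul1r.
pose T := B *m A.
have uT : T \in unitmx by rewrite unitmx_mul uB.
have XT : X *m T = T *m U.
  rewrite /X /T -!mulmxA (mulmxA (invmx B)) mulVmx// mul1mx mulVmx// mulmx1.
  by rewrite !mulmxA.
have T10 : T 1 0 = 0.
  by rewrite -mulmx_e0 /T -mulmxA hA -scalemxAr hB !mxE /= !mulr0.
have dT : T 0 0 != 0 /\ T 1 1 != 0.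
  move: uT; rewrite unitmx2 det2E T10 mulr0 subr0 mulf_eq0 negb_or.
  by move=> /andP[].
case: dT => T00 T11.
clearbody X T; have E i j := congr1 (fun M : 'M[L]_2 => M i j) XT.
have X00 : X 0 0 = U 0 0.
  have := E 0 0; rewrite !mul2E T10 U10 !mulr0 !addr0 [T 0 0 * _]mulrC.
  exact: mulIf.
have X10 : X 1 0 = 0.
  have := E 1 0; rewrite !mul2E T10 U10 mul0r !mulr0 !addr0 => /eqP.
  by rewrite mulf_eq0 (negPf T00) orbF => /eqP.
have X11 : X 1 1 = U 1 1.
  have := E 1 1; rewrite !mul2E T10 X10 !mul0r !add0r [T 1 1 * _]mulrC.
  exact: mulIf.
by rewrite X00 X11.
Qed.

Lemma height_upper (A U : 'M[L]_2) (mu : L) : A \in unitmx ->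
  A *m delta_mx 0 0 = mu *: xi -> U \in unitmx -> U 1 0 = 0 ->
  h (cosetH O (pgl A * pgl U)%g) = h (cosetH O (pgl A)) - v (U 0 0 / U 1 1).
Proof.
move=> uA hA uU U10; have [hp e] := root_char_upper uA hA uU U10.
rewrite -e -(hroot (cosetH O (pgl A)) hp) subrKC; congr (h _).
rewrite cactE -!pglM ?unitmx_mul ?unitmx_inv ?uA ?uU//.
by rewrite -!mulmxA mulVmx// mulmx1.
Qed.

(** With the representative [A] from [iwasawa], all neighbour matrices are upper triangular relative
    to [xi]. Their diagonal ratios are [u] for [Some b] and [u^-1] for [None], of valuation 1 and
    -1. *)
Lemma height_neighbours x : exists n : option F -> tree_vertex v,
  [/\ forall y, tree_adj t x y <-> exists i, y = n i,
      forall b, h (n (Some b)) = h x - 1 & h (n None) = h x + 1].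
Proof.
have [A [mu [uA hA] eA]] := iwasawa (repr x) xi0.
rewrite cosetH_repr in eA.
exists (nbr (pgl A)); split.
- by move=> y; rewrite -eA; exact: tree_adjP.
- move=> b; rewrite /nbr (height_upper uA hA) ?nbr_mx_unit ?mxE//= ?mxE //= eA.
  by rewrite divr1 /u vt.
- rewrite /nbr (height_upper uA hA) ?nbr_mx_unit ?mxE//= ?mxE //= eA.
  by rewrite div1r dvV// /u vt opprK.
Qed.

(** Two injective enumerations of the neighbours by [option F] differ by a permutation. Leaving [n]
    arbitrary allows translates of a list of neighbours. *)
Lemma sum_neighbours (V : nmodType) (f : int -> V) x (n : option F -> tree_vertex v) :
  injective n -> (forall y, tree_adj t x y <-> exists i, y = n i) ->
  \sum_i f (h (n i)) = f (h x + 1) + f (h x - 1) *+ #|F|.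
Proof.
move=> n_inj hn; have [m [hm mS mN]] := height_neighbours x.
have ex i : exists j, n i = m j by apply/hm/hn; exists i.
have [sg sgE] := choice ex.
have sg_inj : injective sg by move=> i j e; apply: n_inj; rewrite !sgE e.
rewrite (eq_bigr (fun i => f (h (m (sg i))))); last by move=> i _; rewrite sgE.
transitivity (\sum_i f (h (m i))); first by rewrite [RHS](reindex_inj sg_inj).
rewrite (bigD1 None)//= mN; congr (_ + _).
rewrite (reindex_omap Some id)/=; last by case.
by rewrite (eq_big xpredT (fun=> f (h x - 1))) ?sumr_const// => b; rewrite ?eqxx// mS.
Qed.

End Heights.

End BruhatTitsTree.
Lemma ncard_fin (I : finType) (T : choiceType) (f : I -> T) (P : pred I) :
  {in P &, injective f} -> ncard [set f i | i in [set i | P i]] = #|P|.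
Proof.
move=> f_inj; have fin : finite_set [set i | P i] by exact: finite_finset.
have hm i : (i \in fset_set [set i | P i]) = P i.
  by rewrite in_fset_set//; apply/idP/idP; rewrite inE.
rewrite /ncard fset_set_image// card_in_imfset /=; last first.
  by move=> i j; rewrite !hm; exact: f_inj.
rewrite cardE; apply: perm_size; apply: uniq_perm; rewrite ?enum_uniq ?fset_uniq//.
by move=> i; rewrite hm mem_enum.
Qed.

Lemma ncard_neq0 (T : choiceType) (A : set T) :
  ncard A != 0%N <-> finite_set A /\ A !=set0.
Proof.
rewrite /ncard; split=> [h|[fA [x Ax]]].
  have fA : finite_set A.
    apply: contrapT => nfA; move: h; rewrite /fset_set.
    by case: pselect => // _; rewrite cardfs0.
  split=> //; apply/set0P; apply: contra h => /eqP ->.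
  by rewrite fset_set0 cardfs0.
by rewrite cardfs_eq0; apply/fset0Pn; exists x; rewrite in_fset_set// inE.
Qed.

(** * Quotient graphs *)

Section QuotientGraphTheory.
Variables (G : groupType) (H Gam : subgroup G).
Variable adj : coset_space H -> coset_space H -> Prop.
Hypothesis adj_inv : forall g x y, sg_set Gam g -> adj x y ->
  adj (cact g x) (cact g y).

Lemma orbit_ofP (x y : coset_space H) :
  orbit_of Gam x = orbit_of Gam y <-> exists2 g, sg_set Gam g & y = cact g x.
Proof.
split=> [/eqP|h]; first by rewrite /orbit_of eqmodE => /asboolP.
by apply/eqP; rewrite /orbit_of eqmodE; apply/asboolP.
Qed.

Lemma orbit_of_repr (v : orbit_space H Gam) : orbit_of Gam (repr v) = v.
Proof. exact: reprK. Qed.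

Lemma orbit_of_cact g (x : coset_space H) :
  sg_set Gam g -> orbit_of Gam (cact g x) = orbit_of Gam x.
Proof. by move=> hg; apply/esym/orbit_ofP; exists g. Qed.

Lemma vstab1 (x : coset_space H) : vstab Gam x 1%g.
Proof. by split; [exact: sg1|exact: cact1]. Qed.

Lemma vstabM (x : coset_space H) a b :
  vstab Gam x a -> vstab Gam x b -> vstab Gam x (a * b)%g.
Proof.
by move=> [ga ax] [gb bx]; split; [exact: sgM|rewrite cactM bx ax].
Qed.

Lemma vstabV (x : coset_space H) a : vstab Gam x a -> vstab Gam x (a^-1)%g.
Proof. by move=> [ga ax]; split; [exact: sgV|rewrite -{1}ax cactK]. Qed.

Section Neighbours.
Variables (x : coset_space H) (I : finType) (n : I -> coset_space H).
Hypothesis n_inj : injective n.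
Hypothesis hn : forall y, adj x y <-> exists i, y = n i.

Let p (i : I) : set (coset_space H * coset_space H) :=
  [set eact g (x, n i) | g in vstab Gam x].

Let pP i j : p i = p j <-> exists2 g, vstab Gam x g & n j = cact g (n i).
Proof.
split=> [e|[g xg e]].
  have : p i (x, n j) by rewrite e; exists 1%g; rewrite /eact/= ?cact1//; exact: vstab1.
  by move=> [g xg [_ <-]]; exists g.
apply/seteqP; split => _ [a xa <-].
  exists (a * g^-1)%g; first by apply: vstabM => //; exact: vstabV.
  by rewrite /eact/= e !cactM cactK (proj2 (vstabV xg)).
exists (a * g)%g; first exact: vstabM.
by rewrite /eact/= e !cactM (proj2 xg).
Qed.

Let act_nbr g i : vstab Gam x g -> exists j, cact g (n i) = n j.
Proof.
move=> [gg gx]; apply/hn; rewrite -{1}gx; apply: adj_inv => //.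
by apply/hn; exists i.
Qed.

(** Orbit-stabilizer: [phi j], the set of elements of the vertex stabilizer that carry [n i] to
    [n j], is a coset of the edge stabilizer whenever [n j] lies in the orbit of [n i], and every
    coset arises so. *)
Lemma group_index_edge i :
  group_index (vstab Gam x) (estab Gam x (x, n i)) = #|[pred j | p i == p j]|.
Proof.
pose phi j := [set a | vstab Gam x a /\ cact a (n i) = n j].
rewrite -(@ncard_fin _ _ phi); last first.
  move=> j j' /eqP/pP[g xg e] _ /seteqP[+ _] => /(_ g (conj xg (esym e)))[_].
  by rewrite -e; apply: n_inj.
rewrite /group_index; congr ncard; apply/seteqP; split=> X.
  move=> [a xa <-]; have [j ej] := act_nbr i xa.
  exists j; first by apply/eqP/pP; exists a.
  apply/seteqP; split=> b.
    move=> [xb eb]; exists (a^-1 * b)%g; last by rewrite mulVKg.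
    have xab : vstab Gam x (a^-1 * b)%g by apply: vstabM => //; exact: vstabV.
    split=> //; rewrite /eact /= (proj2 xab); congr pair.
    by rewrite cactM eb -ej cactK.
  move=> [c [xc [_ ec]] <-]; split; first exact: vstabM.
  by rewrite cactM ec.
move=> [j /eqP/pP[a xa ej] <-]; exists a => //.
apply/seteqP; split=> b.
  move=> [c [xc [_ ec]] <-]; split; first exact: vstabM.
  by rewrite cactM ec.
move=> [xb eb]; exists (a^-1 * b)%g; last by rewrite mulVKg.
have xab : vstab Gam x (a^-1 * b)%g by apply: vstabM => //; exact: vstabV.
split=> //; rewrite /eact /= (proj2 xab); congr pair.
by rewrite cactM eb ej cactK.
Qed.

(** The neighbours are grouped by edge orbit; [f] is constant on each group, and the index counts
    its members. *)
Lemma edge_orbits_sum (C : nzRingType) (f : orbit_space H Gam -> C) :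
  \sum_(o \in edge_orbits Gam adj x)
    (let e := xget (x, x) o in
     (group_index (vstab Gam x) (estab Gam x e))%:R * f (orbit_of Gam e.2)) =
  \sum_i f (orbit_of Gam (n i)).
Proof.
have -> : edge_orbits Gam adj x = p @` setT.
  apply/seteqP; split=> X.
    by move=> [[y z] [/= -> /hn[i ->]] <-]; exists i.
  move=> [i _ <-]; exists (x, n i) => //; split=> //=.
  by apply/hn; exists i.
have fp : finite_set (p @` setT) by apply: finite_image; exact: finite_finset.
rewrite fsbig_finite//=.
rewrite big_seq_cond (eq_bigr (fun o => \sum_(i | p i == o) f (orbit_of Gam (n i)))); last first.
  move=> o; rewrite andbT in_fset_set// inE => -[i _ <-{o}].
  have : p i (xget (x, x) (p i)).
    by apply: (@xgetPex _ (x, x)); exists (x, n i), 1%g; rewrite /eact/= ?cact1//; exact: vstab1.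
  move=> [g xg e]; have [j ej] := act_nbr i xg.
  (* The representative picked by [xget] may end at another neighbour [n j] of the same orbit. *)
  have {}e : xget (x, x) (p i) = (x, n j) by rewrite -e /eact/= (proj2 xg) ej.
  rewrite e /= group_index_edge.
  have -> : p i = p j by apply/pP; exists g.
  rewrite (eq_bigr (fun=> f (orbit_of Gam (n j)))).
    rewrite sumr_const mulr_natl; congr (_ *+ _).
    by apply: eq_card => k; rewrite !inE eq_sym.
  move=> k /eqP/pP[a xa ->]; by rewrite orbit_of_cact//; exact: (proj1 xa).
rewrite -big_seq_cond /=.
rewrite (eq_bigr (fun o => \sum_i if p i == o then f (orbit_of Gam (n i)) else 0)); last first.
  by move=> o _; rewrite big_mkcond.
rewrite exchange_big /=; apply: eq_bigr => i _.
have pi : p i \in fset_set (p @` setT) by rewrite in_fset_set// inE; exists i.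
rewrite (bigD1_seq (p i)) ?fset_uniq//= eqxx big1 ?addr0// => o.
by rewrite eq_sym => /negPf ->.
Qed.

End Neighbours.

Lemma vstab_finite_cact g (x : coset_space H) : sg_set Gam g ->
  finite_set (vstab Gam x) -> finite_set (vstab Gam (cact g x)).
Proof.
move=> hg fx; apply: sub_finite_set (finite_image (fun a => g * a * g^-1)%g fx).
move=> b [hb bx]; exists (g^-1 * b * g)%g; last by rewrite !mulgA mulgV mul1g mulgK.
split; first by apply: sgM => //; apply: sgM => //; exact: sgV.
by rewrite !cactM bx cactK.
Qed.

(** The stabilizer of [x] permutes the finitely many neighbours of [x], and its elements carrying
    [y] to a given one lie in a translate of the finite stabilizer of [y]. *)
Lemma vstab_finite_adj (x y : coset_space H) : adj x y ->
  finite_set [set z | adj x z] -> finite_set (vstab Gam y) ->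
  finite_set (vstab Gam x).
Proof.
move=> xy fN fy.
apply: (@sub_finite_set _ _
    (\bigcup_(z in [set z | adj x z]) [set g | vstab Gam x g /\ cact g y = z])).
  move=> g xg; exists (cact g y) => //=.
  by case: xg => gg gx; rewrite -{1}gx; exact: adj_inv.
apply: bigcup_finite => // z _.
have [[g0 [xg0 e0]]|none] := pselect (exists g, vstab Gam x g /\ cact g y = z).
  apply: sub_finite_set (finite_image (fun a => g0 * a)%g fy) => g [xg e].
  exists (g0^-1 * g)%g; last by rewrite mulVKg.
  split; first by apply: sgM; [apply: sgV; case: xg0|case: xg].
  by rewrite cactM e -e0 cactK.
by apply: sub_finite_set (@finite_set0 _) => g hg; apply: none; exists g.
Qed.

(** An infinite stabilizer has [ncard] 0, and the inverse of 0 is 0, so a positive mass certifies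
    finiteness. *)
Lemma mass_gt0 (R : realType) (v : orbit_space H Gam) :
  0 < mass R v <-> finite_set (vstab Gam (repr v)).
Proof.
rewrite /mass invr_gt0 ltr0n lt0n; split=> [/ncard_neq0[]//|fv].
by apply/ncard_neq0; split=> //; exists 1%g; exact: vstab1.
Qed.

End QuotientGraphTheory.
#[local] Existing Instance totally_filter.

(** * Poincaré sums *)

Section UnconditionalSums.
Variables (K : numClosedFieldType) (I : choiceType).
Implicit Types (x y : I -> K) (l : K).

Lemma partial_sum_cvg_unique x l l' :
  partial_sum x @ totally --> l -> partial_sum x @ totally --> l' -> l = l'.
Proof. by move=> h h'; exact: (cvg_unique _ h h'). Qed.

Lemma partial_sum_cvgZ a x l : partial_sum x @ totally --> l ->
  partial_sum (fun i => a * x i) @ totally --> a * l.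
Proof.
move=> h; rewrite (_ : partial_sum _ = fun A => a * partial_sum x A).
  exact: (@cvgMl_tmp K _ _ _ (partial_sum x) a l h).
by apply/funext => A; rewrite /partial_sum mulr_sumr.
Qed.

Lemma partial_sum_cvg_sum (J : finType) (x : J -> I -> K) (l : J -> K) :
  (forall j, partial_sum (x j) @ totally --> l j) ->
  partial_sum (fun i => \sum_j x j i) @ totally --> \sum_j l j.
Proof.
move=> h.
rewrite (_ : partial_sum _ = fun A => \sum_j partial_sum (x j) A).
  by apply: cvg_big => //; exact: add_continuous.
by apply/funext => A; rewrite /partial_sum exchange_big.
Qed.

Lemma partial_sum_cvg_reindex (s s' : I -> I) y l :
  cancel s s' -> cancel s' s -> partial_sum y @ totally --> l ->
  partial_sum (y \o s) @ totally --> l.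
Proof.
move=> sK s'K h N /h [A _ hA]; exists (s' @` A)%fset => // B /= AB.
have -> : partial_sum (y \o s) B = partial_sum y (s @` B)%fset.
  rewrite /partial_sum -!(big_seq_fsetE _ _ predT) big_imfset //=.
  by move=> i j _ _; exact: (can_inj sK).
apply: hA => /=; apply/fsubsetP => i iA; apply/imfsetP.
exists (s' i); rewrite ?s'K//=; apply: (fsubsetP AB).
by apply/imfsetP; exists i.
Qed.

End UnconditionalSums.

Section PoincareSums.
Variables (K : numClosedFieldType) (G : groupType) (Gam : subgroup G)
  (D : set G) (phi E : G -> K).
Hypothesis phi_inv : forall a g, D a -> phi (a * g)%g = phi g.
Hypothesis D1 : D 1%g.
Let RC : set (set G) := [set [set (a * g)%g | a in D] | g in Gam].
Hypothesis hE : forall g,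
  partial_sum (fun X => if X \in RC then phi (xget 1%g X * g)%g else 0) @ totally
    --> E g.

(** Left invariance of [phi] under [D] makes the term independent of the representative chosen by
    [xget]. *)
Let phi_rep X x g : RC X -> X x -> phi (xget 1%g X * g)%g = phi (x * g)%g.
Proof.
move=> [g0 _ <-{X}] [a Da <-{x}].
have : [set (b * g0)%g | b in D] (xget 1%g [set (b * g0)%g | b in D]).
  by apply: (@xgetPex _ 1%g); exists (a * g0)%g, a.
by move=> [b Db <-]; rewrite -!mulgA (phi_inv _ Db) (phi_inv _ Da).
Qed.

(** Right translation [tr g0] permutes the cosets in [RC], and unconditional sums are insensitive to
    such a reindexing. *)
Lemma poincare_left_invariant g0 g : sg_set Gam g0 -> E (g0 * g)%g = E g.
Proof.
move=> hg0.
pose tr (a : G) (X : set G) := [set (x * a)%g | x in X].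
have trK a : cancel (tr a) (tr a^-1%g).
  move=> X; apply/seteqP; split=> x.
    by move=> [_ [y Xy <-] <-]; rewrite mulgK.
  by move=> Xx; exists (x * a)%g; [exists x|rewrite mulgK].
have trVK a : cancel (tr a^-1%g) (tr a).
  by move=> X; rewrite -{1}(invgK a) trK.
have trRC a X : sg_set Gam a -> RC X -> RC (tr a X).
  move=> ha [b hb <-]; exists (b * a)%g; first exact: sgM.
  apply/seteqP; split=> x.
    by move=> [c Dc <-]; exists (c * b)%g; [exists c|rewrite mulgA].
  by move=> [_ [c Dc <-] <-]; exists c => //; rewrite mulgA.
have := partial_sum_cvg_reindex (trK g0) (trVK g0) (@hE g).
apply: partial_sum_cvg_unique.
rewrite (_ : _ \o _ = fun X : set G => if X \in RC then phi (xget 1%g X * (g0 * g))%g else 0) //.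
apply/funext => X /=.
have -> : (tr g0 X \in RC) = (X \in RC).
  apply/idP/idP; rewrite !inE; last exact: trRC.
  by move=> /(trRC _ _ (sgV hg0)); rewrite trK.
case: ifPn => //; rewrite inE => hX; have [b hb eX] := hX.
have Xb : X b by rewrite -eX; exists 1%g; rewrite ?mul1g.
rewrite (phi_rep _ (trRC _ _ hg0 hX) (x := (b * g0)%g)); last by exists b.
by rewrite (phi_rep _ hX Xb) mulgA.
Qed.

Lemma poincare_eigen (J : finType) (n : J -> G) g (kap : K) :
  (forall a, sg_set Gam a -> \sum_j phi (a * n j)%g = kap * phi (a * g)%g) ->
  \sum_j E (n j) = kap * E g.
Proof.
move=> h; have := partial_sum_cvgZ (a := kap) (@hE g).
apply: partial_sum_cvg_unique.
have := partial_sum_cvg_sum (fun j => @hE (n j)).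
rewrite [X in partial_sum X](_ : _ = fun X : set G =>
  kap * if X \in RC then phi (xget 1%g X * g)%g else 0) //.
apply/funext => X; case: ifPn => hX; last by rewrite mulr0 big1.
move: hX; rewrite inE => -[b hb eX].
have hX : RC X by exists b.
have Xb : X b by rewrite -eX; exists 1%g; rewrite ?mul1g.
rewrite (phi_rep _ hX Xb) -h//.
by apply: eq_bigr => j _; rewrite (phi_rep _ hX Xb).
Qed.

End PoincareSums.
Lemma line_stab_map (k L : fieldType) (f : {rmorphism k -> L}) (xi : 'cV[k]_2) x :
  line_stab xi x -> line_stab (map_mx f xi) (PGL2_map f x).
Proof.
move=> [mu e]; have uM : map_mx f (mx_of x) \in unitmx.
  by rewrite map_unitmx mx_of_unit.
have [c c0 ec] := mx_of_pgl uM.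
exists (c * f mu); rewrite /PGL2_map ec -scalemxAl -map_mxM e map_mxZ.
by rewrite scalerA.
Qed.

Lemma line_basis (k : fieldType) (xi : 'cV[k]_2) : xi != 0 ->
  exists B : 'M[k]_2, exists2 mu, B \in unitmx & B *m xi = mu *: delta_mx 0 0.
Proof.
move=> xi0; have [e0|e0] := eqVneq (xi 0 0) 0.
  exists (mx2 0 1 1 0), (xi 1 0).
    by rewrite unitmx2 det_mx2 mulr1 mulr0 sub0r oppr_eq0 oner_neq0.
  by apply: col2P; rewrite mul2E !mxE /= ?e0; ring.
exists (mx2 1 0 (- xi 1 0 / xi 0 0) 1), (xi 0 0).
  by rewrite unitmx2 det_mx2 mulr1 mul0r subr0 oner_neq0.
by apply: col2P; rewrite mul2E !mxE /=; field.
Qed.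

(** * Heights and eigenfunctions on the quotient *)

Section CuspGeometry.
Variables (R : realType) (F : finFieldType) (k : fieldType)
  (cst : {rmorphism F -> k}) (inf : place k)
  (kv : forall v : place k, completion v) (t : cfield (kv inf)).
Hypothesis ht : laurent_coordinate (cemb (kv inf) \o cst) (cval (kv inf)) t.
Variables (Gk : subgroup (PGL2 k)) (q : R) (r d : nat).
Variables (xi : 'I_r -> 'cV[k]_2) (h : 'I_r -> VT inf kv -> int)
  (gr : 'I_r -> nat -> PGL2 (cfield (kv inf))) (core : 'I_d -> VY inf kv Gk)
  (w : 'I_r -> R).
Hypothesis hq : q = #|F|%:R.
Hypothesis hcusp : cusp_setting t q xi h gr core w.
Notation C := (CC R).
Notation K := (cfield (kv inf)).
Notation O := (PGL2O (cval (kv inf))).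
Notation Gam := (Gamma inf kv Gk).
Notation cstK := (cemb (kv inf) \o cst).

Let t0 : t != 0. Proof. by case: ht. Qed.
Let vt : cval (kv inf) t^-1 = 1. Proof. by case: ht. Qed.

Let residue x : dv_ge (cval (kv inf)) 0 x ->
  exists c, dv_ge (cval (kv inf)) 1 (x - cstK c).
Proof.
case: ht => _ _ + _ => /[apply] -[a [ha _]].
(* The residue is the constant coefficient of the expansion in [t^-1], read off from the truncation
   after one term. *)
by exists (a 0%N); have := ha 1%N; rewrite big_ord1 expr0 mulr1.
Qed.

Lemma constants_gt1 : 1 < q.
Proof. by rewrite hq ltr1n finNzRing_gt1. Qed.

Let nb (x : VT inf kv) : option F -> VT inf kv :=
  nbr (cval (kv inf)) t cstK (repr x).

Let nb_inj x : injective (nb x).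
Proof. exact: nbr_injective. Qed.

Let nbP x y : tree_adj t x y <-> exists i, y = nb x i.
Proof. by rewrite -{1}(cosetH_repr x); apply: tree_adjP. Qed.

Let adj_inv g (x y : VT inf kv) : sg_set Gam g ->
  tree_adj t x y -> tree_adj t (cact g x) (cact g y).
Proof. by move=> _; apply: (tree_adj_cact (cst := cstK)). Qed.

Lemma adjY_sum (f : VY inf kv Gk -> C) v :
  adjY t f v = \sum_i f (orbit_of Gam (nb (repr v) i)).
Proof. exact: (edge_orbits_sum adj_inv (@nb_inj _) (nbP _)). Qed.

Lemma heights_sum c (V : nmodType) (f : int -> V) x (n : option F -> VT inf kv) :
  injective n -> (forall y, tree_adj t x y <-> exists i, y = n i) ->
  \sum_i f (h c (n i)) = f (h c x + 1) + f (h c x - 1) *+ #|F|.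
Proof.
have [B [mu uB hB]] := line_basis (cs_xi hcusp c).
have xi0 : map_mx (cemb (kv inf)) (xi c) != 0.
  by rewrite map_mx_eq0; exact: cs_xi hcusp c.
have uB' : map_mx (cemb (kv inf)) B \in unitmx by rewrite map_unitmx.
have hB' : map_mx (cemb (kv inf)) B *m map_mx (cemb (kv inf)) (xi c) =
    cemb (kv inf) mu *: delta_mx 0 0.
  by rewrite -map_mxM hB map_mxZ map_delta_mx.
have hr p y : line_stab (map_mx (cemb (kv inf)) (xi c)) p ->
    h c (cact p y) - h c y =
    - cval (kv inf) (root_char (map_mx (cemb (kv inf)) B) p).
  by move=> hp; apply: (cs_root hcusp) => //; exists mu.
exact: (sum_neighbours t0 vt residue xi0 uB' hB' hr).
Qed.

Lemma parent_vertex c x : exists y, tree_adj t x y /\ h c y = h c x + 1.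
Proof.
apply: contrapT => no.
(* Summing the indicator of the height [h c x + 1] detects the parent: without one the left side is
   0, while the right side contains a 1. *)
have := heights_sum c (fun m => if m == h c x + 1 then 1%N else 0%N) (@nb_inj x) (nbP x).
rewrite eqxx big1; last first.
  by move=> i _; case: eqP => // e; case: no; exists (nb x i); split=> //; apply/nbP; exists i.
by [].
Qed.

Lemma Gamma_cusp_stab c g : Gamma_cusp Gk xi c g ->
  sg_set Gam g /\ line_stab (map_mx (cemb (kv inf)) (xi c)) g.
Proof.
by move=> [a [ha la] <-]; split; [exists a|exact: line_stab_map].
Qed.

Lemma Gamma_cusp1 c : Gamma_cusp (inf := inf) (kv := kv) Gk xi c 1%g.
Proof.
apply/(cs_stab hcusp); first exact: sg1.
apply/seteqP; split=> x; first by move=> [y hy <-]; rewrite cact1.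
by move=> hx; exists x; rewrite ?cact1.
Qed.

Lemma height_Gamma_cusp c g x : Gamma_cusp Gk xi c g -> h c (cact g x) = h c x.
Proof.
move=> hg; have [gG gl] := Gamma_cusp_stab hg.
have [B [mu uB hB]] := line_basis (cs_xi hcusp c).
have hr y : h c (cact g y) - h c y = - cval (kv inf) (root_char (map_mx (cemb (kv inf)) B) g).
  by apply: (cs_root hcusp) => //; exists mu.
(* g shifts all heights by the constant K0 and preserves the horoball. *)
set K0 := - _ in hr.
have hh y : h c (cact g y) = h c y + K0 by rewrite -(hr y) subrKC.
have heq := (cs_stab hcusp c gG).2 hg.
pose y0 := cosetH O (gr c 1).
have hy0 : h c y0 = 1 by rewrite /y0 (cs_rep hcusp).
have K0ge : 0 <= K0.
  have : horoball h c (cact g y0).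
    by rewrite -heq; exists y0 => //=; rewrite /horoball /= hy0.
  by rewrite /horoball /= hh hy0 lerDl.
have K0le : K0 <= 0.
  have : horoball h c y0 by rewrite /horoball /= hy0.
  rewrite -heq => -[z hz ez]; move: hz; rewrite /horoball /=.
  have : h c z + K0 = 1 by rewrite -hh ez.
  by move=> <-; rewrite gerDl.
by rewrite hh (_ : K0 = 0) ?addr0//; apply/eqP; rewrite eq_le K0ge K0le.
Qed.

Lemma massY_cuspv_gt0 c n : (0 < n)%N -> 0 < massY R (cuspv Gk gr c n).
Proof.
move=> n0; rewrite (cs_mass hcusp)// divr_gt0 ?exprn_gt0 ?mulr_gt0 ?(cs_w hcusp)//.
  by rewrite addr_gt0// (lt_trans ltr01 constants_gt1).
exact: (lt_trans ltr01 constants_gt1).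
Qed.

Lemma finite_neighbours (x : VT inf kv) : finite_set [set y | tree_adj t x y].
Proof.
apply: (@sub_finite_set _ _ (nb x @` setT)).
  by move=> y /nbP[i ->]; exists i.
by apply: finite_image; exact: finite_finset.
Qed.

Lemma vstab_finite (c : 'I_r) (x : VT inf kv) : finite_set (vstab Gam x).
Proof.
(* Climbing towards the cusp c, one reaches the horoball, where the mass of the
   vertices is known to be positive. *)
have [m hm] : exists m : nat, 1 <= h c x + m%:Z.
  exists (`|1 - h c x|)%N; rewrite -lerBlDl; exact: lez_abs.
elim: m x hm => [|m IH] x hm; last first.
  have [y [xy hy]] := parent_vertex c x.
  apply: (vstab_finite_adj adj_inv xy (@finite_neighbours x)); apply: IH.
  by rewrite hy -addrA -intS.
rewrite addr0 in hm.
have [n n0 hn] : exists2 n, (0 < n)%N & h c x = n%:Z.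
  by move: hm; case: (h c x) => // n; exists n.
have := massY_cuspv_gt0 c n0; rewrite -(cs_level hcusp n0 hn) => /mass_gt0 fr.
have /orbit_ofP[g gG ->] : orbit_of Gam (repr (orbit_of Gam x)) = orbit_of Gam x.
  exact: orbit_of_repr.
exact: vstab_finite_cact.
Qed.

Lemma massY_gt0 (c : 'I_r) (v : VY inf kv Gk) : 0 < massY R v.
Proof. by apply/mass_gt0; exact: vstab_finite. Qed.

Lemma VY_cover (v : VY inf kv Gk) : (exists i, v = core i) \/
  exists c n, (0 < n)%N /\ v = cuspv Gk gr c n.
Proof.
have [h1|h1] := pselect (exists c n, (0 < n)%N /\ v = cuspv Gk gr c n).
  by right.
by left; apply/(cs_core hcusp).
Qed.

Lemma core_neq_cuspv i c n : (0 < n)%N -> core i <> cuspv Gk gr c n.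
Proof.
move=> n0 e; have [+ _] := cs_core hcusp (core i).
by move=> /(_ (ex_intro _ i erefl)); apply; exists c, n.
Qed.

Section PoincareFamily.
Variables (E : 'I_r -> PGL2 K -> C -> C).
Hypothesis hE : poincare_family Gk q xi h E.
Variable s : C.
Hypothesis s1 : 1 < complex.Re s.

Let pterm_inv c a g : Gamma_cusp Gk xi c a ->
  pterm q h c s (a * g)%g = pterm q h c s g.
Proof. by move=> ha; rewrite /pterm -cactE height_Gamma_cusp. Qed.

Lemma poincare_left c g0 g : sg_set Gam g0 -> E c (g0 * g)%g s = E c g s.
Proof.
exact: (@poincare_left_invariant C _ Gam (Gamma_cusp Gk xi c) (pterm q h c s)
  (fun g => E c g s) (@pterm_inv c) (Gamma_cusp1 c) (fun g => hE.1 c g s s1)).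
Qed.

Lemma poincare_right c g o : sg_set O o -> E c (g * o)%g s = E c g s.
Proof.
move=> ho; apply: (partial_sum_cvg_unique (hE.1 c (g * o)%g s s1)).
have := hE.1 c g s s1.
rewrite [X in partial_sum X](_ : _ = fun X : set (PGL2 K) =>
  if X \in right_cosets Gk xi c then pterm q h c s (xget 1%g X * (g * o))%g else 0)//.
apply/funext => X; case: ifP => // _.
rewrite /pterm (_ : cosetH O (_ * (g * o))%g = cosetH O (xget 1%g X * g)%g)//.
by rewrite mulgA; apply: cosetH_mulr.
Qed.

(** Descent to the quotient: the inner [repr] lifts a vertex of Y to the tree, the outer one lifts
    it to the group. *)
Lemma poincare_vclass c g : E c g s = E c (repr (repr (vclass Gk g))) s.
Proof.
have /orbit_ofP[a aG e] : orbit_of Gam (repr (vclass Gk g)) = orbit_of Gam (cosetH O g).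
  exact: orbit_of_repr.
set x := repr (vclass Gk g) in e *.
have e' : cosetH O g = cosetH O (a * repr x)%g by rewrite e -[in LHS](cosetH_repr x) cactE.
have -> : g = (a * repr x * ((a * repr x)^-1 * g))%g by rewrite mulVKg.
rewrite poincare_right; last exact/cosetH_eqP.
exact: poincare_left.
Qed.

(** Each term satisfies the equation at the translate of [x]: at height m the neighbours contribute
    [q^(s(m+1)) + q * q^(s(m-1))], which is [(q^s + q^(1-s)) * q^(sm)]. *)
Lemma poincare_eigenfunction c (v : VY inf kv Gk) :
  adjY t (fun v => E c (repr (repr v)) s) v =
  (cpow q s + cpow q (1 - s)) * E c (repr (repr v)) s.
Proof.
rewrite adjY_sum; set x := repr v.
transitivity (\sum_i E c (repr (nb x i)) s).
  apply: eq_bigr => i _; rewrite [RHS]poincare_vclass.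
  by rewrite /vclass cosetH_repr.
apply: (@poincare_eigen C _ Gam (Gamma_cusp Gk xi c) (pterm q h c s)
  (fun g => E c g s) (@pterm_inv c) (Gamma_cusp1 c) (fun g => hE.1 c g s s1)
  _ (fun i => repr (nb x i)) (repr x)).
move=> a aG; rewrite /pterm.
have q0 : 0 < q by apply: lt_trans constants_gt1.
pose f (m : int) : C := cpow q (s * m%:~R).
have inj : injective (fun i => cact a (nb x i)).
  by move=> i j /cact_inj/nb_inj.
have en y : tree_adj t (cact a x) y <-> exists i, y = cact a (nb x i).
  split=> [|[i ->]]; last by apply: adj_inv => //; apply/nbP; exists i.
  move=> /(adj_inv (sgV aG)); rewrite cactK => /nbP[i ei]; exists i.
  by rewrite -ei cactVK.
have := heights_sum c f inj en.
rewrite (eq_bigr (fun i => cpow q (s * (h c (cosetH O (a * repr (nb x i))%g))%:~R))); last first.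
  by move=> i _; rewrite -cactE cosetH_repr.
move=> ->; rewrite -cactE cosetH_repr; set m := h c _.
rewrite /f rmorphD rmorphB /= mulrDr mulrBr mulr1 !cpowD cpowN mulrDl -mulr_natr.
congr (_ + _); first by rewrite mulrC.
have -> : #|F|%:R = cpow q 1 by rewrite (cpow1 q0) hq /toC rmorph_nat.
by ring.
Qed.

End PoincareFamily.

End CuspGeometry.
Lemma is_cvg_series_finite (K : numClosedFieldType) (u : nat -> K) N :
  (forall n, (N <= n)%N -> u n = 0) -> cvgn (series u).
Proof.
move=> uN; apply: (@is_cvg_near_cst _ _ (series u N)).
exists N => // n /= Nn; rewrite /series /= (big_cat_nat (leq0n N) Nn) /=.
by rewrite [X in _ + X]big_nat_cond [X in _ + X]big1 ?addr0// => i /andP[/andP[Ni _] _]; exact: uN.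
Qed.

(** * The scattering matrix *)

Section GenericInvertibility.
Variables (R : realType) (q : R) (r d : nat).
Notation C := (CC R).
Variables (HC : 'M[C]_d) (V : 'M[C]_(d, r)).
Hypothesis q1 : 1 < q.
Let a : C := toC (Num.sqrt q).
Let q0 : 0 < q. Proof. exact: lt_trans q1. Qed.
Let a0 : a != 0.
Proof. by rewrite fmorph_eq0 sqrtr_eq0 -ltNge. Qed.

Lemma zetaE s : cpow q s = a * zeta q s.
Proof. by rewrite /a toC_sqrt// /zeta -cpowD subrKC. Qed.

Lemma cpow1B s : cpow q (1 - s) = a / zeta q s.
Proof.
rewrite /a toC_sqrt// /zeta -cpowB; congr cpow.
by field.
Qed.

Lemma zeta_neq0 s : zeta q s != 0.
Proof. exact: cpow_neq0. Qed.

Lemma near_zeta_neq z (s0 : C) : \forall s \near s0^', zeta q s <> z.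
Proof.
have := near_cpow_neq (a * z) s0 q1; apply: filterS => s h e.
by apply: h; rewrite zetaE e.
Qed.

Lemma near_zetaV_notin (rs : seq C) (s0 : C) :
  \forall s \near s0^', (zeta q s)^-1 \notin rs.
Proof.
elim: rs => [|z rs IH].
  by apply/near_puncturedP; exists 1.
apply: filterS2 IH (near_zeta_neq z^-1 s0) => s h1 h2.
rewrite inE negb_or h1 andbT; apply/eqP => e; apply: h2.
by rewrite -e invrK.
Qed.

Lemma near_Fmx_unit (s0 : C) : \forall s \near s0^', Fmx q HC V (zeta q s) \in unitmx.
Proof.
(* In terms of y = 1 / zeta, y F(zeta) is polynomial with value -a at y = 0. *)
pose A : 'M[{poly C}]_d := 'X *: map_mx polyC HC - (a%:P * (1 + 'X ^+ 2))%:M +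
  'X ^+ 2 *: map_mx polyC (a^-1 *: (V *m adjmx V)).
pose Q := \det A.
have hA y : map_mx (horner_eval y) A =
    y *: HC - (a * (1 + y ^+ 2))%:M + y ^+ 2 *: (a^-1 *: (V *m adjmx V)).
  apply/matrixP => i j; rewrite !mxE /= /horner_eval.
  by rewrite !hornerE hornerMn !hornerE.
have Q0 : Q != 0.
  apply: contra_neq (_ : Q.[0] != 0) => [->|]; first by rewrite horner0.
  rewrite -[Q.[0]]/(horner_eval 0 Q) /Q -det_map_mx hA expr0n /=.
  rewrite !scale0r !addr0 add0r mulr1 -[_%:M]scalemx1 -scaleNr detZ det1 mulr1.
  by rewrite expf_neq0// oppr_eq0.
have [rs Qrs] := closed_field_poly_normal Q.
have := near_zetaV_notin rs s0; apply: filterS => s.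
set y := (zeta q s)^-1 => yrs; have z0 := zeta_neq0 s.
have y0 : y != 0 by rewrite invr_eq0.
have Qy : Q.[y] != 0.
  rewrite Qrs hornerZ mulf_neq0 ?lead_coef_eq0//.
  by move: yrs; rewrite -[rs in \prod_(_ <- rs) _]map_id -root_prod_XsubC map_id.
rewrite unitmxE unitfE; apply: contraNneq Qy => dF.
rewrite -[Q.[y]]/(horner_eval y Q) /Q -det_map_mx hA.
rewrite (_ : _ + _ = y *: Fmx q HC V (zeta q s)).
  by rewrite detZ dF mulr0.
rewrite /Fmx -/a -/y scalerDr scalerBr; congr (_ - _ + _).
  rewrite -[(a * (zeta q s + y))%:M]scalemx1 scalerA -[LHS]scalemx1; congr (_ *: _).
  by rewrite [RHS]mulrCA [in RHS]mulrDr mulVf// expr2.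
by rewrite !scalerA; congr (_ *: _); rewrite expr2 mulrA.
Qed.

End GenericInvertibility.

Lemma scattering_algebra (K : fieldType) (d r : nat) (HC : 'M[K]_d)
    (V : 'M[K]_(d, r)) (V' : 'M[K]_(r, d)) (a z : K) (u : 'cV[K]_d)
    (b m : 'cV[K]_r) :
  a != 0 -> z != 0 ->
  HC *m u + V *m (z *: b + z^-1 *: m) = (a * (z + z^-1)) *: u ->
  a *: (z ^+ 2 *: b + z^-1 ^+ 2 *: m) + V' *m u =
    (a * (z + z^-1)) *: (z *: b + z^-1 *: m) ->
  let Fz := HC - (a * (z + z^-1))%:M + (z^-1 / a) *: (V *m V') in
  Fz \in unitmx ->
  u = (z^-1 - z) *: (invmx Fz *m V *m b) /\
  m = (- 1%:M + ((z^-1 - z) / a) *: (V' *m invmx Fz *m V)) *m b.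
Proof.
move=> a0 z0 e1 e2 Fz uF.
(* Expanding [(z + z^-1) (z b + z^-1 m)] leaves just [b + m] beyond the terms already on the
   left. *)
have eV : V' *m u = a *: (b + m).
  apply: (addrI (a *: (z ^+ 2 *: b + z^-1 ^+ 2 *: m))); rewrite e2.
  apply/matrixP => i j; rewrite !mxE; field.
  by rewrite z0.
(* By [eV], the correction term of [Fz] contributes [z^-1 V (b + m)], which cancels the outgoing
   part [z^-1 V m] of the core equation. *)
have eF : Fz *m u = (z^-1 - z) *: (V *m b).
  rewrite /Fz mulmxDl mulmxBl mul_scalar_mx -e1 -scalemxAl -mulmxA eV.
  rewrite opprD addNKr -scalemxAr scalerA divfK// !mulmxDr -!scalemxAr.
  rewrite scalerDr scalerBl opprD addrACA addNr addr0 addrC.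
  by [].
have eu : u = (z^-1 - z) *: (invmx Fz *m V *m b).
  by rewrite -mulmxA scalemxAr -eF mulKmx.
split=> //.
rewrite mulmxDl mulNmx mul1mx -scalemxAl -!mulmxA.
apply: (addrI b); rewrite addNKr.
apply: (can_inj (scalerK a0)); rewrite -eV eu scalerA mulrCA mulfV// mulr1.
by rewrite -scalemxAr !mulmxA.
Qed.

(** * Eigenfunctions of Y in the coordinates of the graph model *)

Section ScatteringOfEigenfunctions.
Variables (R : realType) (F : finFieldType) (k : fieldType)
  (cst : {rmorphism F -> k}) (inf : place k)
  (kv : forall v : place k, completion v) (t : cfield (kv inf)).
Hypothesis ht : laurent_coordinate (cemb (kv inf) \o cst) (cval (kv inf)) t.
Variables (Gk : subgroup (PGL2 k)) (q : R) (r d : nat).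
Variables (xi : 'I_r -> 'cV[k]_2) (h : 'I_r -> VT inf kv -> int)
  (gr : 'I_r -> nat -> PGL2 (cfield (kv inf))) (core : 'I_d -> VY inf kv Gk)
  (w : 'I_r -> R).
Hypothesis hq : q = #|F|%:R.
Hypothesis hcusp : cusp_setting t q xi h gr core w.
Notation C := (CC R).
Variables (HC : 'M[C]_d) (V : 'M[C]_(d, r)).
Hypothesis hJ : graph_model t q gr core HC V.
Notation cuspv := (cuspv Gk gr).
Let a : C := toC (Num.sqrt q).
Let q1 : 1 < q. Proof. exact: constants_gt1 hq. Qed.
Let q0 : 0 < q. Proof. exact: lt_trans q1. Qed.
Let a0 : a != 0. Proof. by rewrite fmorph_eq0 sqrtr_eq0 -ltNge. Qed.

(* [graph_model] only describes J on functions that are square summable along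
   the cusps; as adjacency is local, it extends to all functions by cutting them
   off far out in the cusps. *)
Definition truncate N (f : VY inf kv Gk -> C) (v : VY inf kv Gk) : C :=
  if `[< exists c n, (N < n)%N /\ v = cuspv c n >] then 0 else f v.

Lemma truncate_core N f i : truncate N f (core i) = f (core i).
Proof.
rewrite /truncate; case: asboolP => // -[c [n [Nn]]].
by move/(core_neq_cuspv hcusp (leq_trans (ltn0Sn N) Nn)).
Qed.

Lemma truncate_cuspv N f c n : (0 < n <= N)%N ->
  truncate N f (cuspv c n) = f (cuspv c n).
Proof.
move=> /andP[n0 nN]; rewrite /truncate; case: asboolP => // -[c' [n' [Nn' e]]].
have [_ nn] := cs_cuspv_inj hcusp n0 (leq_trans (ltn0Sn N) Nn') e.
by rewrite -nn ltnNge nN in Nn'.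
Qed.

Lemma truncate_near f v : exists N0, forall N, (N0 <= N)%N -> truncate N f v = f v.
Proof.
have [[i ->]|[c [n [n0 ->]]]] := VY_cover hcusp v.
  by exists 0%N => N _; exact: truncate_core.
by exists n => N nN; apply: truncate_cuspv; rewrite n0.
Qed.

(** Only finitely many neighbours of [v] enter, so a late enough cutoff leaves all of their values
    intact. *)
Lemma adjY_truncate f v : exists N0, forall N, (N0 <= N)%N ->
  adjY t (ofU (truncate N f)) v = adjY t (ofU f) v.
Proof.
have [N0 hN0] := choice (truncate_near f).
pose vs i := orbit_of (Gamma inf kv Gk) (nbr (cval (kv inf)) t (cemb (kv inf) \o cst) (repr (repr v)) i).
exists (\max_i N0 (vs i))%N => N hN; rewrite !(adjY_sum ht).
apply: eq_bigr => i _; rewrite /ofU hN0//.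
by apply: leq_trans hN; exact: (leq_bigmax (F := fun i => N0 (vs i))).
Qed.

Lemma truncate_square_summable N f c :
  cvgn (series (fun n => `|truncate N f (cuspv c n.+1)| ^+ 2)).
Proof.
apply: (@is_cvg_series_finite C _ N) => n Nn.
rewrite /truncate (_ : `[< _ >] = true); first by rewrite normr0 expr0n.
by apply/asboolP; exists c, n.+1.
Qed.

Lemma Jop_core f :
  core_part core (Jop t f) = HC *m core_part core f + V *m cusp_part gr f 1.
Proof.
have [N0 hN0] := choice (fun i => adjY_truncate f (core i)).
pose N := maxn 1 (\max_i N0 i).
have [hc _ _] := hJ.2 (truncate N f) (@truncate_square_summable N f).
have e1 : core_part core (truncate N f) = core_part core f.
  by apply/matrixP => i j; rewrite !mxE truncate_core.
have e2 : cusp_part gr (truncate N f) 1 = cusp_part gr f 1.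
  by apply/matrixP => i j; rewrite !mxE truncate_cuspv// leq_maxl.
rewrite -e1 -e2 -hc; apply/matrixP => i j; rewrite !mxE /Jop /toU hN0//.
by rewrite leq_max (leq_bigmax (F := N0)) orbT.
Qed.

Lemma Jop_cusp1 f :
  cusp_part gr (Jop t f) 1 = a *: cusp_part gr f 2 + adjmx V *m core_part core f.
Proof.
have [N0 hN0] := choice (fun c => adjY_truncate f (cuspv c 1)).
pose N := maxn 2 (\max_i N0 i).
have [_ hc _] := hJ.2 (truncate N f) (@truncate_square_summable N f).
have e1 : core_part core (truncate N f) = core_part core f.
  by apply/matrixP => i j; rewrite !mxE truncate_core.
have e2 : cusp_part gr (truncate N f) 2 = cusp_part gr f 2.
  by apply/matrixP => i j; rewrite !mxE truncate_cuspv// leq_maxl.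
rewrite -e1 -e2 -hc; apply/matrixP => i j; rewrite !mxE /Jop /toU hN0//.
by rewrite leq_max (leq_bigmax (F := N0)) orbT.
Qed.

(** The index [c] provides a cusp to climb to, from which finiteness of the stabilizers, and so
    positivity of the mass, is derived. *)
Lemma toU_neq0 (c : 'I_r) (v : VY inf kv Gk) : toC (Num.sqrt (massY R v)) != 0.
Proof. by rewrite fmorph_eq0 sqrtr_eq0 -ltNge (massY_gt0 ht hq hcusp c). Qed.

Lemma ofU_toU (c : 'I_r) (f : VY inf kv Gk -> C) : ofU (toU f) = f.
Proof. by apply/funext => v; rewrite /ofU /toU mulrAC mulfV ?mul1r// (toU_neq0 c). Qed.

Lemma Wsqrt_mul (b : 'cV[C]_r) c : (Wsqrt w *m b) c 0 = toC (Num.sqrt (w c)) * b c 0.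
Proof. by rewrite /Wsqrt mul_diag_mx !mxE. Qed.

Lemma Wsqrt_unit : Wsqrt w \in unitmx.
Proof.
rewrite unitmxE unitfE det_diag; apply/prodf_neq0 => c _.
by rewrite mxE fmorph_eq0 sqrtr_eq0 -ltNge (cs_w hcusp).
Qed.

Let kap : C := toC (Num.sqrt (q + 1)).
Let kap0 : kap != 0.
Proof. by rewrite fmorph_eq0 sqrtr_eq0 -ltNge addr_gt0. Qed.

(** The square root of the mass [w (q + 1) q^-n] supplies [Wsqrt], the common factor [kap], and
    [a^-n], which turns [q^(ns) = a^n zeta^n] into [zeta^n] and likewise for [1 - s]. *)
Lemma cusp_part_toU (f : VY inf kv Gk -> C) s (b m : 'cV[C]_r) n : (0 < n)%N ->
  (forall c, f (cuspv c n) =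
     cpow q (n%:R * s) * b c 0 + cpow q (n%:R * (1 - s)) * m c 0) ->
  cusp_part gr (toU f) n =
    zeta q s ^+ n *: (kap *: (Wsqrt w *m b)) +
    (zeta q s)^-1 ^+ n *: (kap *: (Wsqrt w *m m)).
Proof.
move=> n0 hf; have eb := Wsqrt_mul b; have em := Wsqrt_mul m.
move: (Wsqrt w *m b) (Wsqrt w *m m) eb em => b' m' eb em.
apply/matrixP => c j; rewrite ord1 !mxE {j} eb em.
rewrite /toU hf (cs_mass hcusp)//.
rewrite sqrtrM ?mulr_ge0 ?addr_ge0 ?ltW ?(cs_w hcusp)//.
rewrite sqrtrM ?ltW ?(cs_w hcusp)//.
rewrite /toC !rmorphM /= -!/(toC _) -/kap.
have -> : toC (Num.sqrt (q ^- n)) = a ^- n.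
  have -> : Num.sqrt (q ^- n) = (Num.sqrt q) ^- n.
    rewrite -[in LHS](sqr_sqrtr (ltW q0)) -exprM mulnC exprM -exprVn sqrtr_sqr.
    by rewrite ger0_norm// invr_ge0 exprn_ge0// sqrtr_ge0.
  by rewrite [toC _]fmorphV; congr (_^-1); exact: rmorphXn.
rewrite !cpowMn (zetaE q1) (cpow1B q1) -/a.
move: (zeta q s) (zeta_neq0 q s) => z z0; rewrite !exprMn exprVn.
have an : a ^+ n != 0 by rewrite expf_neq0.
have zn : z ^+ n != 0 by rewrite expf_neq0.
move: (a ^+ n) (z ^+ n) an zn (toC (Num.sqrt (w c))) => A Z A0 Z0 W.
move: kap => kap'; by field; rewrite A0 Z0.
Qed.

(** The equations of J at the core and at the vertices [(c, 1)] involve only levels 1 and 2 of the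
    cusps, and they already determine the core values and [m] from [b]. The factor [kap] cancels in
    the relation between [m] and [b]. *)
Lemma scattering_of_eigenfunction (f : VY inf kv Gk -> C) s (b m : 'cV[C]_r) :
  'I_r -> Fmx q HC V (zeta q s) \in unitmx ->
  (forall v, adjY t f v = (cpow q s + cpow q (1 - s)) * f v) ->
  (forall c n, (0 < n <= 2)%N -> f (cuspv c n) =
     cpow q (n%:R * s) * b c 0 + cpow q (n%:R * (1 - s)) * m c 0) ->
  core_part core (toU f) = ((zeta q s)^-1 - zeta q s) *:
    (invmx (Fmx q HC V (zeta q s)) *m V *m (kap *: (Wsqrt w *m b))) /\
  Wsqrt w *m m = Smx q HC V (zeta q s) *m (Wsqrt w *m b).
Proof.
move=> c0 uF hA hf.
have J_eig v : Jop t (toU f) v = (a * (zeta q s + (zeta q s)^-1)) * toU f v.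
  rewrite /Jop (ofU_toU c0) {1}/toU hA (zetaE q1) (cpow1B q1) -/a /toU.
  ring.
have c1 := cusp_part_toU (n := 1) isT (fun c => hf c 1%N isT).
have c2 := cusp_part_toU (n := 2) isT (fun c => hf c 2 isT).
rewrite !expr1 in c1.
have e1 := Jop_core (toU f); have e2 := Jop_cusp1 (toU f).
rewrite c1 in e1; rewrite c2 in e2.
have eJ1 : core_part core (Jop t (toU f)) =
    (a * (zeta q s + (zeta q s)^-1)) *: core_part core (toU f).
  by apply/matrixP => i j; rewrite !mxE J_eig.
have eJ2 : cusp_part gr (Jop t (toU f)) 1 =
    (a * (zeta q s + (zeta q s)^-1)) *: cusp_part gr (toU f) 1.
  by apply/matrixP => i j; rewrite !mxE J_eig.
rewrite eJ1 in e1; rewrite eJ2 c1 in e2.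
have [-> em] := scattering_algebra a0 (zeta_neq0 _ _) (esym e1) (esym e2) uF.
split=> //; apply: (can_inj (scalerK kap0)).
by rewrite em -scalemxAr.
Qed.

Lemma eigenfunction_unique (f g : VY inf kv Gk -> C) s (b m m' : 'cV[C]_r) (c0 : 'I_r) :
  Fmx q HC V (zeta q s) \in unitmx ->
  (forall v, adjY t f v = (cpow q s + cpow q (1 - s)) * f v) ->
  (forall v, adjY t g v = (cpow q s + cpow q (1 - s)) * g v) ->
  (forall c n, (0 < n <= 2)%N -> f (cuspv c n) =
     cpow q (n%:R * s) * b c 0 + cpow q (n%:R * (1 - s)) * m c 0) ->
  (forall c n, (0 < n <= 2)%N -> g (cuspv c n) =
     cpow q (n%:R * s) * b c 0 + cpow q (n%:R * (1 - s)) * m' c 0) ->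
  (forall i, f (core i) = g (core i)) /\ m = m'.
Proof.
move=> uF hAf hAg hf hg.
have [ef mf] := scattering_of_eigenfunction c0 uF hAf hf.
have [eg mg] := scattering_of_eigenfunction c0 uF hAg hg.
split; last by apply: (can_inj (mulKmx Wsqrt_unit)); rewrite mf mg.
move=> i; have : core_part core (toU f) i 0 = core_part core (toU g) i 0.
  by rewrite ef eg.
by rewrite !mxE /toU => /(mulfI (toU_neq0 c0 _)).
Qed.

End ScatteringOfEigenfunctions.

(** * Comparison of the two families *)

Lemma near_Re_gt1 (R : realType) :
  \forall s \near (2 : CC R)^', 1 < complex.Re s.
Proof.
apply/near_puncturedP; exists 1 => // s _ /(le_lt_trans (normc_ge_Re _)).
have e2 : (2 : CC R) = toC 2 by rewrite /toC rmorph_nat.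
have -> : complex.Re (s - 2) = complex.Re s - 2 by rewrite e2; case: s.
rewrite -[ltRHS](rmorph1 (real_complex R)) ltcR ltr_norml => /andP[h _].
lra.
Qed.

Theorem proposition2p25
  (R : realType)
  (F : finFieldType) (k : fieldType) (cst : {rmorphism F -> k})
  (hk : global_function_field cst)
  (inf : place k) (hinf : degree_one cst inf)
  (kv : forall v : place k, completion v)
  (t : cfield (kv inf))
  (ht : laurent_coordinate (cemb (kv inf) \o cst) (cval (kv inf)) t)
  (Kf : subgroup (Gf inf kv))
  (hKo : open (sg_set Kf)) (hKc : compact (sg_set Kf))
  (g0 : Gf inf kv)
  (Gk : subgroup (PGL2 k)) (hGk : Gk = arith_group Kf g0)
  (q : R) (hq : q = #|F|%:R)
  (r d : nat) (hd : (0 < d)%N)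
  (xi : 'I_r -> 'cV[k]_2) (h : 'I_r -> VT inf kv -> int)
  (gr : 'I_r -> nat -> PGL2 (cfield (kv inf)))
  (core : 'I_d -> VY inf kv Gk) (w : 'I_r -> R)
  (hcusp : cusp_setting t q xi h gr core w)
  (HC : 'M[CC R]_d) (V : 'M[CC R]_(d, r))
  (hJ : graph_model t q gr core HC V)
  (cE : CC R -> 'cV[CC R]_r -> VY inf kv Gk -> CC R) (Saut : CC R -> 'M[CC R]_r)
  (hcE : normalized_family t q gr HC V cE Saut)
  (E : 'I_r -> PGL2 (cfield (kv inf)) -> CC R -> CC R)
  (hE : poincare_family Gk q xi h E)
  (M : CC R -> 'M[CC R]_r) (hM : constant_term q gr E M) :
  [/\ forall c g,
        eq_mero (E c g) (fun s => cE s (delta_mx c 0) (vclass Gk g)),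
      eq_mero M Saut &
      eq_mero Saut
        (fun s => invmx (Wsqrt w) *m Smx q HC V (zeta q s) *m Wsqrt w)].
Proof.
have q1 : 1 < q := constants_gt1 hq.
have good s0 : \forall s \near s0^', [/\ Fmx q HC V (zeta q s) \in unitmx,
    zeta q s != 1 & zeta q s != -1].
  apply: filterS3 (near_Fmx_unit HC V q1 s0) (near_zeta_neq q1 1 s0)
    (near_zeta_neq q1 (-1) s0) => s uF z1 zN1.
  by split => //; exact/eqP.
have [hA mer_cE _] := hcE.
have cE_exp s c c' n : Fmx q HC V (zeta q s) \in unitmx ->
    zeta q s != 1 -> zeta q s != -1 -> (0 < n)%N ->
    cE s (delta_mx c 0) (cuspv Gk gr c' n) =
    (c' == c)%:R * cpow q (n%:R * s) + Saut s c' c * cpow q (n%:R * (1 - s)).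
  move=> uF z1 zN1 n0; rewrite (hA s _ uF z1 zN1).2// -colE !mxE andbT.
  by congr (_ + _); rewrite mulrC.
have E_cE c g : eq_mero (E c g) (fun s => cE s (delta_mx c 0) (vclass Gk g)).
  (* Around 2 the Poincaré series converges, so its sum is an honest eigenfunction and can be
     compared pointwise with [cE]. *)
  apply: (meromorphic_identity (s0 := 2)); [exact: hE.2|exact: mer_cE|].
  have near_exp n : (0 < n)%N -> \forall s \near (2 : CC R)^', forall c',
      E c (gr c' n) s = (c' == c)%:R * cpow q (n%:R * s) +
        M s c' c * cpow q (n%:R * (1 - s)).
    by move=> n0; apply: filter_forall => c'; exact: hM.
  (* The neighbourhood on which a constant term formula holds may shrink with [n]; since [g] lies
     over a single vertex of Y, one level besides 1 and 2 suffices. *)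
  have near_n : \forall s \near (2 : CC R)^', forall c' n, (0 < n)%N ->
      vclass Gk g = cuspv Gk gr c' n ->
      E c (gr c' n) s = (c' == c)%:R * cpow q (n%:R * s) +
        M s c' c * cpow q (n%:R * (1 - s)).
    have [[c' [n [n0 e]]]|none] := pselect (exists c' n, (0 < n)%N /\
        vclass Gk g = cuspv Gk gr c' n).
      have := near_exp n n0; apply: filterS => s hs c'' n' n'0 e'.
      have [<- <-] := cs_cuspv_inj hcusp n0 n'0 (etrans (esym e) e').
      exact: hs.
    apply: filterS (near_Re_gt1 R) => s _ c' n n0 e; case: none.
    by exists c', n.
  have near_12 : \forall s \near (2 : CC R)^', 1 < complex.Re s /\
      forall c' n, (0 < n <= 2)%N ->
      E c (gr c' n) s = (c' == c)%:R * cpow q (n%:R * s) +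
        M s c' c * cpow q (n%:R * (1 - s)).
    apply: filterS3 (near_Re_gt1 R) (near_exp 1%N isT) (near_exp 2 isT).
    by move=> s s1 h1 h2; split=> // c' [|[|[|]]].
  apply: filterS3 near_12 (good 2) near_n => s [s1 hM12] [uF z1 zN1] hMn.
  pose f (v : VY inf kv Gk) := E c (repr (repr v)) s.
  have fE g' : E c g' s = f (vclass Gk g') := poincare_vclass hcusp hE s1 c g'.
  have f_exp c' n : (0 < n <= 2)%N -> f (cuspv Gk gr c' n) =
      cpow q (n%:R * s) * (delta_mx c 0 : 'cV[CC R]_r) c' 0 +
      cpow q (n%:R * (1 - s)) * (col c (M s)) c' 0.
    move=> n12; rewrite /cuspv -fE !mxE andbT ![cpow _ _ * _]mulrC.
    exact: hM12.
  have g_exp c' n : (0 < n <= 2)%N -> cE s (delta_mx c 0) (cuspv Gk gr c' n) =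
      cpow q (n%:R * s) * (delta_mx c 0 : 'cV[CC R]_r) c' 0 +
      cpow q (n%:R * (1 - s)) * (col c (Saut s)) c' 0.
    by move=> /andP[n0 _]; rewrite colE; exact: (hA s _ uF z1 zN1).2.
  have [e_core /matrixP e_col] := eigenfunction_unique ht hq hcusp hJ c uF
    (poincare_eigenfunction ht hq hcusp hE s1 c) (hA s _ uF z1 zN1).1 f_exp g_exp.
  rewrite fE; have [[i ->]|[c' [n [n0 e]]]] := VY_cover hcusp (vclass Gk g).
    exact: e_core.
  rewrite e cE_exp// {1}/cuspv -fE hMn//.
  by have := e_col c' 0; rewrite !mxE => ->.
split => //.
(* The outgoing coefficients are compared at level 1, where the incoming terms agree and [cpow] is
   nonzero. *)
- move=> s0.
  have h1 : \forall s \near s0^', forall c c',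
      E c (gr c' 1%N) s = cE s (delta_mx c 0) (cuspv Gk gr c' 1).
    by apply: filter_forall => c; apply: filter_forall => c'; exact: E_cE.
  have h2 : \forall s \near s0^', forall c c',
      E c (gr c' 1%N) s = (c' == c)%:R * cpow q (1%:R * s) +
        M s c' c * cpow q (1%:R * (1 - s)).
    by apply: filter_forall => c; apply: filter_forall => c'; exact: hM.
  apply: filterS3 h1 h2 (good s0) => s k1 k2 [uF z1 zN1].
  apply/matrixP => c' c; have := k2 c c'; rewrite k1 cE_exp// => /addrI.
  by move/(mulIf (cpow_neq0 _ _)).
- move=> s0; apply: filterS (good s0) => s [uF z1 zN1].
  have uW := Wsqrt_unit hcusp.
  apply: (can_inj (mulKmx uW)); rewrite !mulmxA mulmxV// mul1mx.
  (* Column [j] is obtained by applying the scattering relation to the eigenfunction with incoming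
     part the [j]-th basis vector. *)
  apply/matrixP => i j; pose e : 'cV[CC R]_r := delta_mx j 0.
  have ent (A : 'M[CC R]_r) : A i j = (A *m e) i 0 by rewrite -colE mxE.
  have [_ eS] := scattering_of_eigenfunction ht hq hcusp hJ j uF
    (hA s e uF z1 zN1).1 (fun c n n12 => (hA s e uF z1 zN1).2 c n (andP n12).1).
  by rewrite !ent -!mulmxA eS.
Qed.
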